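(* Let $G_3$ be the finite group with triality $S=\langle\sigma,\rho\rangle$ described in the context, and let $M_3=\{x^{-1}x^{\sigma}: x\in G_3\}$ with the multiplication $m\cdot n=(m^{-1})^{\rho}\,n\,(m^{-1})^{\rho^2}$ for $m,n\in M_3$. Then $M_3$ is the Moufang loop corresponding to $G_3$, and: (1) $M_3$ is generated by $\{x_1,x_2,x_3,[x_1,x_2],[x_1,x_3],[x_2,x_3],(x_1,x_2,x_3),x_1^2,x_2^2,x_3^2\}$, where $x_i=a_i^{-1}a_i^{\sigma}$ for $i=1,2,3$; (2) $|M_3|=2^{10}$; (3) $M_3$ is a free loop in the variety $\mathcal{E}$ generated by code loops.
   Context: For a group, $[x,y]=x^{-1}y^{-1}xy$. $G_3$ is the nilpotent group of class $3$ generated by $a_1,a_2,a_3,b_1,b_2,b_3$ with the defining relations $a_i^4=b_i^4=1$ and, with $u_{ij}=[a_i,a_j]$, $v_{ij}=[b_i,b_j]$, $p_{ij}=[a_i,b_j]$: (1) $[a_i,b_i]=1$ and $a_i^2,b_i^2$ central; (2) for $i<j$: $u_{ij}=u_{ji}$, $v_{ij}=v_{ji}$, $u_{ij}^2=v_{ij}^2=1$; (3) $u_{ij},v_{ij}$ central; (4) $p_{ij}=p_{ji}$, $p_{ij}^2=1$ for $i<j$; (5) for $\{i,j,k\}=\{1,2,3\}$, $z_{ijk}:=[p_{ij},a_k]$ with $z_{ijk}=z_{jik}=z_{kij}$; (6) $t_{ijk}:=[p_{ij},b_k]$ with $t_{ijk}=t_{jik}=t_{kij}$; (7) $z_{ijk}^2=t_{ijk}^2=1$;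 (8) $z_{ijk},t_{ijk}$ central. (Its order is $2^{23}$.) The automorphisms are $\sigma$: $a_i\mapsto b_i$, $b_i\mapsto a_i$ (so $u_{ij}\mapsto v_{ij}$, $v_{ij}\mapsto u_{ij}$, $p_{ij}\mapsto p_{ij}$, $z_{123}\leftrightarrow t_{123}$), and $\rho$: $a_i\mapsto b_i$, $b_i\mapsto a_i^{-1}b_i^{-1}$ (so $u_{ij}\mapsto v_{ij}$, $v_{ij}\mapsto u_{ij}v_{ij}$, $p_{ij}\mapsto v_{ij}p_{ij}$, $z_{123}\mapsto t_{123}$, $t_{123}\mapsto z_{123}t_{123}$); $S=\langle\sigma,\rho\rangle\cong S_3$ and $[g,\sigma][g,\sigma]^\rho[g,\sigma]^{\rho^2}=1$ for all $g$, where $[g,\sigma]=g^{-1}g^\sigma$. In the loop $M_3$, $[x,y]$ and $(x,y,z)$ denote loop commutator and associator: $xy=(yx)[x,y]$, $(xy)z=(x(yz))(x,y,z)$, products taken with the loop multiplication $\cdot$. A loop is Moufang if $((xy)x)z=x(y(xz))$. $\mathcal{E}$ is the variety of Moufang loops satisfying $x^4=1$, $[x,y]^2=1$, $(x,y,z)^2=1$, $[x^2,y]=1$, $[[x,y],t]=1$, $[(x,y,z),t]=1$, $(x^2,y,z)=1$, $([x,y],z,t)=1$, $((x,y,z),t,s)=1$; it is the variety generated by code loops. *)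

(* Defs.v *)
From mathcomp Require Import all_boot all_order all_fingroup all_solvable.
Set Implicit Arguments. Unset Strict Implicit. Unset Printing Implicit Defensive.
Import GroupScope.
Local Open Scope group_scope.

Definition i1 : 'I_3 := @Ordinal 3 0 isT.
Definition i2 : 'I_3 := @Ordinal 3 1 isT.
Definition i3 : 'I_3 := @Ordinal 3 2 isT.

Section G3.
Variable gT : finGroupType.

Definition central (g : gT) := forall h : gT, commute g h.

Definition G3_relations (a b : 'I_3 -> gT) : Prop :=
  let u i j := [~ a i, a j] in
  let v i j := [~ b i, b j] in
  let p i j := [~ a i, b j] in
  (forall i, a i ^+ 4 = 1 /\ b i ^+ 4 = 1) /\
  [/\
      (forall i, [~ a i, b i] = 1 /\ central (a i ^+ 2) /\ central (b i ^+ 2)),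
      (forall i j : 'I_3, (i < j)%N ->
         [/\ u i j = u j i, v i j = v j i, u i j ^+ 2 = 1 & v i j ^+ 2 = 1]),
      (forall i j : 'I_3, (i < j)%N -> central (u i j) /\ central (v i j))
      & (forall i j : 'I_3, (i < j)%N -> p i j = p j i /\ p i j ^+ 2 = 1)] /\
  (forall i j k : 'I_3, [&& i != j, j != k & i != k] ->
         [/\ [~ p i j, a k] = [~ p j i, a k], [~ p i j, a k] = [~ p k i, a j],
             [~ p i j, b k] = [~ p j i, b k] & [~ p i j, b k] = [~ p k i, b j]]) /\
  (forall i j k : 'I_3, [&& i != j, j != k & i != k] ->
         [/\ [~ p i j, a k] ^+ 2 = 1, [~ p i j, b k] ^+ 2 = 1,
             central [~ p i j, a k] & central [~ p i j, b k]]).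

Definition G3_gens (a b : 'I_3 -> gT) : {set gT} :=
  [set a i | i : 'I_3] :|: [set b i | i : 'I_3].

Definition M3 (sigma : gT -> gT) : {set gT} := [set x^-1 * sigma x | x : gT].
Definition M3mul (rho : gT -> gT) (m n : gT) : gT :=
  rho (m^-1) * n * rho (rho (m^-1)).

Definition moufang_loop_on (M : {set gT}) (mul : gT -> gT -> gT) : Prop :=
  [/\ (forall m n, m \in M -> n \in M -> mul m n \in M),
      (1 : gT) \in M,
      (forall m, m \in M -> mul 1 m = m /\ mul m 1 = m),
      (forall m n, m \in M -> n \in M ->
         (exists! x, x \in M /\ mul m x = n) /\ (exists! y, y \in M /\ mul y m = n))
    & (forall x y z, x \in M -> y \in M -> z \in M ->
         mul (mul (mul x y) x) z = mul x (mul y (mul x z)))].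

Definition ldiv_on (M : {set gT}) (mul : gT -> gT -> gT) (u v : gT) : gT :=
  odflt 1 [pick z in M | mul u z == v].

Definition loop_generated (M : {set gT}) (mul : gT -> gT -> gT) (X : {set gT}) :=
  forall S : {set gT}, S \subset M -> X \subset S ->
    (forall u v, u \in S -> v \in S -> mul u v \in S) ->
    (forall u v w, u \in S -> v \in S -> w \in M -> mul u w = v -> w \in S) ->
    (forall u v w, u \in S -> v \in S -> w \in M -> mul w u = v -> w \in S) ->
    M \subset S.

End G3.

Section Loops.
Variable T : Type.
Variables (mul ld : T -> T -> T) (e : T).

Definition lsq x := mul x x.
(* loop commutator: x y = (y x) [x,y] *)
Definition lcomm x y := ld (mul y x) (mul x y).
(* loop associator: (x y) z = (x (y z)) (x,y,z) *)
Definition lassoc x y z := ld (mul x (mul y z)) (mul (mul x y) z).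

(* the identities defining the variety E (Moufang law stated separately),
   quantified over the elements of the domain D *)
Definition E_identities (D : T -> Prop) : Prop :=
  forall x y z t s, D x -> D y -> D z -> D t -> D s ->
  [/\ lsq (lsq x) = e, lsq (lcomm x y) = e & lsq (lassoc x y z) = e] /\
  [/\ lcomm (lsq x) y = e, lcomm (lcomm x y) t = e & lcomm (lassoc x y z) t = e] /\
  [/\ lassoc (lsq x) y z = e, lassoc (lcomm x y) z t = e
     & lassoc (lassoc x y z) t s = e].

Definition moufang_law (D : T -> Prop) : Prop :=
  forall x y z, D x -> D y -> D z -> mul (mul (mul x y) x) z = mul x (mul y (mul x z)).

End Loops.

Definition is_loop (T : Type) (mul ld rd : T -> T -> T) (e : T) : Prop :=
  [/\ forall x, mul e x = x /\ mul x e = x,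
      forall x y, mul x (ld x y) = y /\ ld x (mul x y) = y
    & forall x y, mul (rd y x) x = y /\ rd (mul y x) x = y].

Definition E_loop (T : Type) (mul ld rd : T -> T -> T) (e : T) : Prop :=
  [/\ is_loop mul ld rd e, moufang_law mul (fun _ => True)
    & E_identities mul ld e (fun _ => True)].

(* Main.v *)
Require Import Defs.
From mathcomp Require Import all_boot all_order all_algebra all_fingroup all_solvable.
Import GroupScope.
Local Open Scope group_scope.

(* Modulo its central elementary abelian subgroup of order 2^7, an E-loop on three
   generators is elementary abelian: squares, commutators and associators are
   central involutions, the Moufang law makes the associator symmetric and
   trilinear, and commutators are bilinear up to associators. Hence in every E-loop
   the products [(x1^u1 x2^u2) x3^u3] multiply according to one cocycle [theta].
   Collection in [G_3] gives a normal form with 23 binary digits, unique because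
   [G_3] has order 2^23. In these coordinates [M_3] is the set of all pairs
   (u, z) in F_2^3 x F_2^7, and its multiplication is given by the same [theta],
   so that sending (u, z) to the corresponding product in an E-loop is a
   homomorphism. *)

(** * Central involutions *)

(** Tabulating the multiplication of M_3 directly would take 2^20 products, each a long collection
    in a group of order 2^23. Only the u-coordinate is therefore tabulated, over F_2^3. The central
    coordinate is carried symbolically: the central elements of M_3 have the form c = h^-1 sigma(h)
    with h a central involution, and they satisfy rho(c) rho^2(c) = c, so they factor out of m.n.
    The natural representatives g^-1 sigma(g), with g = a_1^u1 a_2^u2 a_3^u3, multiply by [theta]
    plus a coboundary; [kappa] absorbs that coboundary, so that the coordinates of M_3 match the
    products in an E-loop exactly. The Moufang law and the identities of E are not computed in G_3:
    they are proved for the abstract loop on F_2^3 x F_2^7, where they follow from a finite check on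
    [theta] and from centrality, and are then transported to M_3. *)

Section CentralInvolutions.

Variables (T : Type) (op : T -> T -> T) (e : T).
Hypothesis op1x : forall x, op e x = x.
Hypothesis opx1 : forall x, op x e = x.

(** [op] is not assumed associative, so membership in the nucleus and the centre is stated as rules
    that move [c] to the left. The record serves both E-loops and the centre of G_3. *)
Record central_inv (c : T) : Prop := CentralInv {
  cinv_sq : op c c = e;
  cinvC : forall x, op x c = op c x;
  cinvA : forall x y, op (op c x) y = op c (op x y);
  cinvCA : forall x y, op x (op c y) = op c (op x y) }.

Lemma central_inv1 : central_inv e.
Proof. by split=> *; rewrite !(op1x, opx1). Qed.

Lemma central_invM c d : central_inv c -> central_inv d -> central_inv (op c d).
Proof.
move=> hc hd; split=> [|x|x y|x y].
- by rewrite (cinvA _ hc) (cinvCA _ hc) (cinv_sq _ hd) opx1 (cinv_sq _ hc).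
- by rewrite (cinvA _ hc) (cinvCA _ hc) (cinvC _ hd).
- by rewrite !(cinvA _ hc) (cinvA _ hd).
- by rewrite !(cinvA _ hc) (cinvCA _ hc) (cinvCA _ hd).
Qed.

Lemma cinvK c x : central_inv c -> op c (op c x) = x.
Proof. by move=> hc; rewrite -(cinvA _ hc) (cinv_sq _ hc) op1x. Qed.

Lemma cinv_eq c d : central_inv d -> op c d = e -> c = d.
Proof. by move=> hd cd; rewrite -(cinvK d c hd) -(cinvC _ hd c) cd opx1. Qed.

Definition pw (c : T) (k : bool) := if k then c else e.

Lemma central_inv_pw c k : central_inv c -> central_inv (pw c k).
Proof. by case: k => // _; apply: central_inv1. Qed.

Lemma pwD c k l : central_inv c -> op (pw c k) (pw c l) = pw c (k (+) l).
Proof. by move=> hc; case: k l => [] []; rewrite /= ?op1x ?opx1 ?(cinv_sq _ hc). Qed.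

Fixpoint invprod (cs : seq T) (v : seq bool) : T :=
  match cs, v with
  | c :: cs', k :: v' => op (pw c k) (invprod cs' v')
  | _, _ => e
  end.

(** The shorter vector is padded with zeros, in agreement with [invprod], which treats missing
    exponents as zero. *)
Fixpoint xors (v w : seq bool) : seq bool :=
  match v, w with
  | k :: v', l :: w' => (k (+) l) :: xors v' w'
  | [::], _ => w
  | _, [::] => v
  end.

Fixpoint all_cinv (cs : seq T) : Prop :=
  if cs is c :: cs' then central_inv c /\ all_cinv cs' else True.

Lemma central_inv_invprod cs v : all_cinv cs -> central_inv (invprod cs v).
Proof.
elim: cs v => [|c cs IH] [|k v] /=; try by move=> _; apply: central_inv1.
by case=> hc hcs; apply: central_invM; [apply: central_inv_pw | apply: IH].
Qed.

Lemma invprodD cs v w :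
  all_cinv cs -> op (invprod cs v) (invprod cs w) = invprod cs (xors v w).
Proof.
elim: cs v w => [|c cs IH] [|k v] [|l w] //=; rewrite ?op1x ?opx1 //.
case=> hc hcs; have hk := central_inv_pw c k hc; have hl := central_inv_pw c l hc.
rewrite -IH // -pwD // (cinvA _ hk) (cinvCA _ hl); apply/esym.
by rewrite (cinvA _ hk).
Qed.

(* Reflection for products of central involutions: equality of terms is decided
   by the parity of each factor. *)
Inductive cterm := CVar of nat | COne | CMul of cterm & cterm.

Fixpoint cdenote (cs : seq T) (t : cterm) : T :=
  match t with
  | CVar n => nth e cs n
  | COne => e
  | CMul s t => op (cdenote cs s) (cdenote cs t)
  end.

Fixpoint cparity (t : cterm) : seq bool :=
  match t with
  | CVar n => rcons (nseq n false) true
  | COne => [::]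
  | CMul s t => xors (cparity s) (cparity t)
  end.

Lemma cdenoteE cs t : all_cinv cs -> cdenote cs t = invprod cs (cparity t).
Proof.
move=> hcs; elim: t => [n||s IHs t IHt] /=; last by rewrite IHs IHt invprodD.
- elim: n cs {hcs} => [|n IH] [|c cs] //=; last by rewrite op1x IH.
  by case: cs => [|? ?]; rewrite opx1.
- by case: cs {hcs}.
Qed.

Lemma invprod_all0 cs v : ~~ has id v -> invprod cs v = e.
Proof.
elim: cs v => [|c cs IH] [|[] v] //= hv.
by rewrite op1x IH.
Qed.

Lemma cdenote_triv cs t : all_cinv cs -> ~~ has id (cparity t) -> cdenote cs t = e.
Proof. by move=> hcs /invprod_all0 h; rewrite cdenoteE. Qed.

Lemma central_inv_cdenote cs t : all_cinv cs -> central_inv (cdenote cs t).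
Proof. by move=> hcs; rewrite cdenoteE //; apply: central_inv_invprod. Qed.

Lemma cdenote_eq cs s t :
  all_cinv cs -> ~~ has id (xors (cparity s) (cparity t)) ->
  cdenote cs s = cdenote cs t.
Proof.
move=> hcs h; apply: cinv_eq; first exact: central_inv_cdenote.
exact: (cdenote_triv cs (CMul s t)).
Qed.

End CentralInvolutions.

(** * Loops in the variety E *)

Section ELoop.

Variables (T : Type) (mul ld rd : T -> T -> T) (e : T).
Hypothesis EL : E_loop mul ld rd e.

Local Notation "x * y" := (mul x y).
Local Notation S := (lsq mul).
Local Notation K := (lcomm mul ld).
Local Notation A := (lassoc mul ld).
Local Notation cinv := (central_inv T mul e).

Lemma el1x x : e * x = x. Proof. by case: EL => [[/(_ x)[]]]. Qed.
Lemma elx1 x : x * e = x. Proof. by case: EL => [[/(_ x)[]]]. Qed.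
Lemma el_ldK x y : x * ld x y = y.
Proof. by case: EL => [[_ /(_ x y)[]]]. Qed.
Lemma el_ldE x y : ld x (x * y) = y.
Proof. by case: EL => [[_ /(_ x y)[]]]. Qed.
Lemma el_rdE x y : rd (y * x) x = y.
Proof. by case: EL => [[_ _ /(_ x y)[]]]. Qed.
Lemma el_moufang x y z : ((x * y) * x) * z = x * (y * (x * z)).
Proof. by case: EL => _ + _; apply. Qed.

(** * Inverses and the right-handed Moufang law *)

Lemma el_mulI x y z : x * y = x * z -> y = z.
Proof. by move=> h; rewrite -(el_ldE x y) h el_ldE. Qed.
Lemma el_Imul x y z : y * x = z * x -> y = z.
Proof. by move=> h; rewrite -(el_rdE x y) h el_rdE. Qed.

Definition linv x := ld x e.

Lemma mul_linv x : x * linv x = e. Proof. exact: el_ldK. Qed.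

Lemma linvK x z : linv x * (x * z) = z.
Proof. by apply: (el_mulI x); rewrite -el_moufang mul_linv el1x. Qed.

Lemma linv_mul x : linv x * x = e. Proof. by rewrite -{2}(elx1 x) linvK. Qed.

(** With w written as x y, this is the Moufang law at z = x^-1. *)
Lemma mul_mulK x w : (w * x) * linv x = w.
Proof. by rewrite -(el_ldK x w) el_moufang mul_linv elx1. Qed.

Lemma linvE x y : x * y = e -> linv x = y.
Proof. by move=> h; rewrite /linv -h el_ldE. Qed.

Lemma linvM x y : linv (x * y) = linv y * linv x.
Proof.
apply: (el_mulI (x * y)); rewrite mul_linv; apply/esym.
have h : linv y = linv (x * y) * x by rewrite -{2}(mul_mulK y x) linvK.
by rewrite h mul_mulK mul_linv.
Qed.

Lemma linv_linv x : linv (linv x) = x. Proof. exact/linvE/linv_mul. Qed.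

(** Inversion is an anti-automorphism, so it turns the Moufang law into its mirror image. *)
Lemma el_moufang_r x y z : z * (x * (y * x)) = ((z * x) * y) * x.
Proof.
have := el_moufang (linv x) (linv y) (linv z).
by move/(congr1 linv); rewrite !linvM !linv_linv.
Qed.

(** Inverting (c x) y = c (x y) gives (x y) c = x (y c), as c is its own inverse; commutativity of c
    then yields x (c y) = c (x y). *)
Lemma nuclear_cinv c :
    c * c = e -> (forall x, c * x = x * c) ->
    (forall x y, (c * x) * y = c * (x * y)) -> cinv c.
Proof.
move=> cc cC cA; have ci := linvE _ _ cc.
have cR x y : (x * y) * c = x * (y * c).
  have := cA (linv y) (linv x) => /(congr1 linv).
  by rewrite !linvM ci !linv_linv.
by split=> // x y; rewrite ?cA // cC -cR -cC.
Qed.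

Lemma el_id x y z t s :
  [/\ S (S x) = e, S (K x y) = e & S (A x y z) = e] /\
  [/\ K (S x) y = e, K (K x y) t = e & K (A x y z) t = e] /\
  [/\ A (S x) y z = e, A (K x y) z t = e & A (A x y z) t s = e].
Proof. by case: EL => _ _ /(_ x y z t s I I I I I). Qed.

Lemma lcomm_eq x y : K x y = e -> x * y = y * x.
Proof. by move=> h; rewrite -(el_ldK (y * x) (x * y)) -/(K x y) h elx1. Qed.

Lemma lassoc_eq x y z : A x y z = e -> (x * y) * z = x * (y * z).
Proof.
by move=> h; rewrite -(el_ldK (x * (y * z)) ((x * y) * z)) -/(A x y z) h elx1.
Qed.

Lemma central_inv_sq x : cinv (S x).
Proof.
apply: nuclear_cinv => [|y|y z]; first by case: (el_id x x x x x) => [[]].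
  by apply: lcomm_eq; case: (el_id x y x x x) => _ [[]].
by apply: lassoc_eq; case: (el_id x y z x x) => _ [_ []].
Qed.

Lemma central_inv_comm x y : cinv (K x y).
Proof.
apply: nuclear_cinv => [|t|z t]; first by case: (el_id x y x x x) => [[]].
  by apply: lcomm_eq; case: (el_id x y x t x) => _ [[]].
by apply: lassoc_eq; case: (el_id x y z t x) => _ [_ []].
Qed.

Lemma central_inv_assoc x y z : cinv (A x y z).
Proof.
apply: nuclear_cinv => [|t|t s]; first by case: (el_id x y z x x) => [[]].
  by apply: lcomm_eq; case: (el_id x y z t x) => _ [[]].
by apply: lassoc_eq; case: (el_id x y z t s) => _ [_ []].
Qed.

Lemma mulCK x y : x * y = K x y * (y * x).
Proof. by rewrite -(cinvC _ _ _ _ (central_inv_comm x y)) el_ldK. Qed.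

Lemma mulAA x y z : (x * y) * z = A x y z * (x * (y * z)).
Proof. by rewrite -(cinvC _ _ _ _ (central_inv_assoc x y z)) el_ldK. Qed.

Lemma lcommP c x y : x * y = c * (y * x) -> K x y = c.
Proof. by rewrite mulCK => /el_Imul. Qed.

Lemma lassocP c x y z : (x * y) * z = c * (x * (y * z)) -> A x y z = c.
Proof. by rewrite mulAA => /el_Imul. Qed.

(** * Symmetry and trilinearity of the associator *)

Lemma lassoc_cl c x y z : cinv c -> A (c * x) y z = A x y z.
Proof.
move=> hc; apply: lassocP; rewrite !(cinvA _ _ _ _ hc).
by rewrite (cinvCA _ _ _ _ hc) mulAA.
Qed.

Lemma lassoc_cm c x y z : cinv c -> A x (c * y) z = A x y z.
Proof.
move=> hc; apply: lassocP; rewrite !(cinvA _ _ _ _ hc, cinvCA _ _ _ _ hc).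
by rewrite mulAA.
Qed.

Lemma lassoc_cr c x y z : cinv c -> A x y (c * z) = A x y z.
Proof.
move=> hc; apply: lassocP; rewrite !(cinvA _ _ _ _ hc, cinvCA _ _ _ _ hc).
by rewrite mulAA.
Qed.

Lemma lassoc_Cl x y z t : A (x * y) z t = A (y * x) z t.
Proof. by rewrite mulCK lassoc_cl //; apply: central_inv_comm. Qed.
Lemma lassoc_Cm x y z t : A z (x * y) t = A z (y * x) t.
Proof. by rewrite mulCK lassoc_cm //; apply: central_inv_comm. Qed.
Lemma lassoc_Cr x y z t : A z t (x * y) = A z t (y * x).
Proof. by rewrite mulCK lassoc_cr //; apply: central_inv_comm. Qed.

Lemma lassoc1l x y : A e x y = e.
Proof. by apply: lassocP; rewrite !el1x. Qed.
Lemma lassoc1m x y : A x e y = e.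
Proof. by apply: lassocP; rewrite !(el1x, elx1). Qed.
Lemma lassoc1r x y : A x y e = e.
Proof. by apply: lassocP; rewrite !(el1x, elx1). Qed.

Lemma lassocxx x y : A x x y = e.
Proof. by apply: lassocP; rewrite el1x -{1}(elx1 x) el_moufang el1x. Qed.
Lemma lassoc_xx x y : A y x x = e.
Proof. by apply: lassocP; rewrite el1x -{4}(el1x x) el_moufang_r elx1. Qed.

Lemma lassoc_Sl x y z : A (x * x) y z = e.
Proof. by rewrite -[x * x]elx1 lassoc_cl ?lassoc1l //; apply: central_inv_sq. Qed.
Lemma lassoc_Sm x y z : A y (x * x) z = e.
Proof. by rewrite -[x * x]elx1 lassoc_cm ?lassoc1m //; apply: central_inv_sq. Qed.
Lemma lassoc_Sr x y z : A y z (x * x) = e.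
Proof. by rewrite -[x * x]elx1 lassoc_cr ?lassoc1r //; apply: central_inv_sq. Qed.

Lemma mulxxy x y : x * (x * y) = S x * y.
Proof. by rewrite (lassoc_eq _ _ _ (lassocxx x y)). Qed.

(* Rebracket [((x y) z) w] in two ways. *)
Lemma lassoc_pentagon x y z w :
  A x y z * (A x (y * z) w * A y z w) = A (x * y) z w * A x y (z * w).
Proof.
apply: (el_Imul (x * (y * (z * w)))).
have cA a b c := cinvA _ _ _ _ (central_inv_assoc a b c).
have cCA a b c := cinvCA _ _ _ _ (central_inv_assoc a b c).
rewrite !cA -(mulAA x y (z * w)) -(mulAA (x * y) z w) -(cCA y z w x) -(mulAA y z w).
by rewrite -(mulAA x (y * z) w) -cA -(mulAA x y z).
Qed.

(** This lemma and the next two are the pentagon with two equal neighbours: the associators with an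
    adjacent repetition or a square vanish, and two terms survive. *)
Lemma lassoc_addl2 x y z : A x (x * y) z = A x y z.
Proof.
have := lassoc_pentagon x x y z.
rewrite lassocxx lassoc_Sl lassocxx !el1x.
by apply: cinv_eq; [exact: el1x|exact: elx1| exact: central_inv_assoc].
Qed.

Lemma lassoc_addr2 x y z : A x (y * z) z = A x y z.
Proof.
have := lassoc_pentagon x y z z.
rewrite !lassoc_xx lassoc_Sr !elx1 (cinvC _ _ _ _ (central_inv_assoc _ _ _)).
by apply: cinv_eq; [exact: el1x|exact: elx1| exact: central_inv_assoc].
Qed.

Lemma lassoc_shift x y z : A (x * y) y z = A x y (y * z).
Proof.
have := lassoc_pentagon x y y z.
rewrite lassoc_xx lassocxx lassoc_Sm !elx1 => /esym.
by apply: cinv_eq; [exact: el1x|exact: elx1| exact: central_inv_assoc].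
Qed.

(** Rebracketing ((x y) x) z into x (y (x z)) costs these two associators, and by the Moufang law
    the total cost is trivial. *)
Lemma lassoc_moufang x y z : A (x * y) x z = A x y (x * z).
Proof.
have := el_moufang x y z; rewrite mulAA (mulAA x y).
rewrite -[X in _ = X]el1x -(cinvA _ _ _ _ (central_inv_assoc _ _ _)) => /el_Imul.
by apply: cinv_eq; [exact: el1x|exact: elx1| exact: central_inv_assoc].
Qed.

(** A(x, y, x w) = A(x y, x, w) = A(y x, x, w) = A(y, x, x w). Taking w = x z turns the last
    argument into z times a central square, which drops out. *)
Lemma lassocC12 x y z : A x y z = A y x z.
Proof.
have h w : A x y (x * w) = A y x (x * w).
  by rewrite -lassoc_moufang lassoc_Cl lassoc_shift.
by have := h (x * z); rewrite mulxxy !lassoc_cr //; apply: central_inv_sq.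
Qed.

Lemma lassoc_addr3 x y z : A x y (y * z) = A x y z.
Proof. by rewrite -lassoc_shift lassoc_Cl lassocC12 lassoc_addl2 lassocC12. Qed.

(** A(x, y, z) = A(x, y z, (y z) z), and (y z) z is y times a central square; what remains, A(x, z
    y, y), is A(x, z, y). *)
Lemma lassocC23 x y z : A x y z = A x z y.
Proof.
rewrite -lassoc_addr2 -lassoc_addr3 (lassoc_eq _ _ _ (lassoc_xx z y)).
have hS := central_inv_sq z.
by rewrite -[z * z]/(S z) (cinvC _ _ _ _ hS y) lassoc_cr // lassoc_Cm lassoc_addr2.
Qed.

(* Modulo symmetry, the product of these three pentagons is the claim. *)
Lemma lassocDr x y z w : A x y (z * w) = A x y z * A x y w.
Proof.
have P1 : A x z w * (A x y (z * w) * A y z w) = A (x * z) w y * A x z (w * y).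
  by rewrite -lassoc_pentagon (lassocC23 x y) (lassocC12 y z) (lassocC23 z y).
have P2 : A x y z * (A (x * z) w y * A x z w) = A (x * y) z w * A x y (z * w).
  rewrite (lassocC12 x y) (lassocC23 _ w) (lassocC12 _ y) lassoc_pentagon.
  by rewrite lassoc_Cl (lassocC12 y x).
have P3 : A x y w * (A x z (w * y) * A y z w) = A (x * y) z w * A x y (z * w).
  rewrite (lassocC23 x z) (lassoc_Cm w y) (lassocC23 y z) lassoc_pentagon.
  by rewrite (lassocC23 _ w) (lassoc_Cr w).
have hsq c d : cinv c -> d = c -> d * c = e by move=> hc ->; apply: cinv_sq hc.
have cM c d := central_invM _ _ _ elx1 c d.
have hA a b c := central_inv_assoc a b c.
apply: cinv_eq; [exact: el1x | exact: elx1 | by apply: cM |].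
move/hsq: P1 => P1; move/hsq: P2 => P2; move/hsq: P3 => P3.
pose cs := [:: A x y z; A x y w; A x y (z * w); A x z w; A y z w;
               A (x * z) w y; A x z (w * y); A (x * y) z w].
pose m := CMul; pose v := CVar.
have := cdenote_triv _ _ _ el1x elx1 cs
  (m (m (v 2) (m (v 0) (v 1%N)))
    (m (m (m (v 3) (m (v 2) (v 4))) (m (v 5) (v 6)))
    (m (m (m (v 0) (m (v 5) (v 3))) (m (v 7) (v 2)))
       (m (m (v 1%N) (m (v 6) (v 4))) (m (v 7) (v 2)))))).
rewrite /= P1 ?P2 ?P3 ?elx1; [|by apply: cM ..].
by apply=> //; do !split; apply: central_inv_assoc.
Qed.

Lemma lassocDl x y z w : A (z * w) x y = A z x y * A w x y.
Proof. by rewrite lassocC12 lassocC23 lassocDr !(lassocC23 x y) !(lassocC12 x). Qed.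

Lemma lassocDm x y z w : A x (z * w) y = A x z y * A x w y.
Proof. by rewrite lassocC23 lassocDr !(lassocC23 x y). Qed.

(** * Commutators and the product formula *)

Lemma lcomm1l x : K e x = e.
Proof. by apply: lcommP; rewrite !(el1x, elx1). Qed.
Lemma lcomm1r x : K x e = e.
Proof. by apply: lcommP; rewrite !(el1x, elx1). Qed.

Lemma lcommC x y : K x y = K y x.
Proof.
apply: lcommP; rewrite (mulCK y x) (cinvK _ _ _ el1x) //; exact: central_inv_comm.
Qed.

Lemma mulAV x y z : x * (y * z) = A x y z * ((x * y) * z).
Proof. by rewrite mulAA (cinvK _ _ _ el1x) //; apply: central_inv_assoc. Qed.

(** Moving x past y and then past z takes three rebracketings. Their associators agree by symmetry,
    so two of the three cancel. *)
Lemma lcommDr x y z : K x (y * z) = K x y * (K x z * A x y z).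
Proof.
have hA a b c := central_inv_assoc a b c; have hK a b := central_inv_comm a b.
apply: lcommP.
rewrite (mulAV x y z) (mulCK x y) (cinvA _ _ _ _ (hK x y)) (mulAA y x z).
rewrite (mulCK x z) (cinvCA _ _ _ _ (hK x z)) (mulAV y z x).
rewrite (lassocC12 y x z) (lassocC23 y z x) (lassocC12 y x z).
rewrite (cinvCA _ _ _ _ (hA x y z) (K x y)) (cinvK _ _ _ el1x) //.
by rewrite !(cinvA _ _ _ _ (hK _ _)).
Qed.

(** The basic collection move: bring s and q together, swap them, and bracket again. By trilinearity
    A(p, s, q) and A(s, q, t) each occur twice and cancel. *)
Lemma mul_interchange p s q t :
  (p * s) * (q * t) = (K s q * (A p s t * A p q t)) * ((p * q) * (s * t)).
Proof.
have hA a b c := central_inv_assoc a b c; have hK a b := central_inv_comm a b.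
rewrite (mulAA p s) (mulAV s q t) (mulCK s q) (cinvA _ _ _ _ (hK s q)).
rewrite (mulAA q s t) (cinvCA _ _ _ _ (hA s q t) p) (cinvCA _ _ _ _ (hK s q) p).
rewrite (cinvCA _ _ _ _ (hA q s t) p) (mulAV p q (s * t)).
rewrite (lassocC12 q s t) (lassocDr p s) (lassocDr p q) (lassocC23 p q s).
have cM c d := central_invM _ _ _ elx1 c d.
set X := (p * q) * (s * t).
rewrite -(cinvA _ _ _ _ (hA s q t) _ X) -(cinvA _ _ _ _ (hK s q) _ X).
rewrite -(cinvA _ _ _ _ (hA s q t) _ X) -(cinvA _ _ _ _ (cM _ _ (hA _ _ _) (hA _ _ _)) _ X).
congr (_ * _); pose m := CMul; pose v := CVar.
apply: (cdenote_eq _ _ _ el1x elx1 [:: K s q; A p s t; A p q t; A p s q; A s q t]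
  (m (m (v 3) (v 1%N)) (m (v 4) (m (v 0) (m (v 4) (m (v 3) (v 2))))))
  (m (v 0) (m (v 1%N) (v 2)))) => //.
Qed.

Variables x1 x2 x3 : T.

Local Notation pw := (pw T e).

Definition loop_cgens := [:: S x1; S x2; S x3; K x1 x2; K x1 x3; K x2 x3; A x1 x2 x3].

Lemma all_cinv_loop_cgens : all_cinv T mul e loop_cgens.
Proof.
have hA a b c := central_inv_assoc a b c; have hK a b := central_inv_comm a b; have hS a := central_inv_sq a.
by do 7! split=> //.
Qed.

Definition loop_rep (u1 u2 u3 : bool) := (pw x1 u1 * pw x2 u2) * pw x3 u3.

Lemma pw_mul x k l : pw x k * pw x l = pw (S x) (k && l) * pw x (k (+) l).
Proof. by case: k l => [] []; rewrite /= ?el1x ?elx1. Qed.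

(** Two interchanges collect the product, the outer one moving x3^u3 and the inner one x2^u2. The
    associator exponent has two sources: the commutator of x3^u3 with x1^v1 x2^v2 gives u3 v1 v2,
    and the associator of the two x1, x2 parts with x3^v3 gives the 2 by 2 determinant times v3. *)
Lemma loop_rep_mul u1 u2 u3 v1 v2 v3 :
  loop_rep u1 u2 u3 * loop_rep v1 v2 v3 =
  invprod T mul e loop_cgens
    [:: u1 && v1; u2 && v2; u3 && v3; u2 && v1; u3 && v1; u3 && v2;
        (u3 && v1 && v2) (+) (((u1 && v2) (+) (u2 && v1)) && v3)]
  * loop_rep (u1 (+) v1) (u2 (+) v2) (u3 (+) v3).
Proof.
have hA a b c := central_inv_assoc a b c; have hK a b := central_inv_comm a b; have hS a := central_inv_sq a.
have hpw c k : cinv c -> cinv (pw c k) by exact: (central_inv_pw _ _ _ el1x elx1).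
rewrite /loop_rep mul_interchange.
have -> : K (pw x3 u3) (pw x1 v1 * pw x2 v2) =
   pw (K x1 x3) (u3 && v1) * (pw (K x2 x3) (u3 && v2) * pw (A x1 x2 x3) (u3 && v1 && v2)).
  rewrite lcommDr (lcommC x1) (lcommC x2) (lassocC23 x1) (lassocC12 x1).
  by case: u3 v1 v2 => [] [] []; rewrite /= ?lcomm1l ?lcomm1r ?lassoc1l ?lassoc1m ?lassoc1r ?elx1.
have -> : A (pw x1 u1 * pw x2 u2) (pw x3 u3) (pw x3 v3) = e.
  by case: u3 v3 => [] []; rewrite /= ?lassoc_xx ?lassoc1m ?lassoc1r.
have -> : A (pw x1 u1 * pw x2 u2) (pw x1 v1 * pw x2 v2) (pw x3 v3)
   = pw (A x1 x2 x3) (((u1 && v2) (+) (u2 && v1)) && v3).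
  rewrite !lassocDl !lassocDm.
  case: u1 u2 v1 v2 v3 => [] [] [] [] [];
  rewrite /= ?lassoc1l ?lassoc1m ?lassoc1r ?lassocxx ?(lassocC12 x2 x1) ?el1x ?elx1 //.
  exact: cinv_sq (hA _ _ _).
have -> : (pw x1 u1 * pw x2 u2) * (pw x1 v1 * pw x2 v2) =
   pw (K x1 x2) (u2 && v1) * (pw (S x1) (u1 && v1) * (pw (S x2) (u2 && v2) *
     (pw x1 (u1 (+) v1) * pw x2 (u2 (+) v2)))).
  rewrite mul_interchange (lcommC x1).
  have -> : K (pw x2 u2) (pw x1 v1) = pw (K x2 x1) (u2 && v1).
    by case: u2 v1 => [] []; rewrite /= ?lcomm1l ?lcomm1r.
  have -> : A (pw x1 u1) (pw x2 u2) (pw x2 v2) = e.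
    by case: u2 v2 => [] []; rewrite /= ?lassoc_xx ?lassoc1m ?lassoc1r.
  have -> : A (pw x1 u1) (pw x1 v1) (pw x2 v2) = e.
    by case: u1 v1 => [] []; rewrite /= ?lassocxx ?lassoc1l ?lassoc1m.
  rewrite !elx1 !pw_mul (cinvA _ _ _ _ (hpw _ (u1 && v1) (hS x1))).
  by rewrite (cinvCA _ _ _ _ (hpw _ (u2 && v2) (hS x2))).
rewrite (pw_mul x3) el1x.
have c1 := hpw _ (u1 && v1) (hS x1); have c2 := hpw _ (u2 && v2) (hS x2).
have c3 := hpw _ (u3 && v3) (hS x3); have c4 := hpw _ (u2 && v1) (hK x1 x2).
rewrite !(cinvA _ _ _ _ c4) !(cinvA _ _ _ _ c1) !(cinvA _ _ _ _ c2) (cinvCA _ _ _ _ c3).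
have c5 := hpw _ (u3 && v1) (hK x1 x3); have c6 := hpw _ (u3 && v2) (hK x2 x3).
have c7 := hpw _ (u3 && v1 && v2) (hA x1 x2 x3).
have c8 := hpw _ (((u1 && v2) (+) (u2 && v1)) && v3) (hA x1 x2 x3).
rewrite -(pwD _ _ _ el1x elx1 _ _ _ (hA x1 x2 x3)) elx1.
have cM c d := central_invM _ _ _ elx1 c d.
(* The exponents no longer matter: what is left is a reordering of eight arbitrary central
   involutions. *)
move: {hpw}(pw (S x1) _) (pw (S x2) _) (pw (S x3) _) (pw (K x1 x2) _) (pw (K x1 x3) _)
  (pw (K x2 x3) _) (pw (A x1 x2 x3) _) (pw (A x1 x2 x3) _) (_ * pw x3 _)
  c1 c2 c3 c4 c5 c6 c7 c8 => d1 d2 d3 d4 d5 d6 d7 d8 R c1 c2 c3 c4 c5 c6 c7 c8.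
rewrite -!(cinvA _ _ _ _ c2 _ R) -!(cinvA _ _ _ _ c1 _ R).
rewrite -!(cinvA _ _ _ _ c4 _ R) -(cinvA _ _ _ _ (cM _ _ (cM _ _ c5 (cM _ _ c6 c7)) c8)).
congr (_ * _); pose m := CMul; pose v := CVar.
apply: (cdenote_eq _ _ _ el1x elx1 [:: d1; d2; d3; d4; d5; d6; d8; d7]
  (m (m (m (v 4) (m (v 5) (v 6))) (v 7)) (m (v 3) (m (v 0) (m (v 1%N) (v 2)))))
  (m (v 0) (m (v 1%N) (m (v 2) (m (v 3) (m (v 4) (m (v 5) (m (v 6) (v 7))))))))) => //.
Qed.

End ELoop.

(** * Collection in G_3 *)

Notation bool3 := (bool * bool * bool)%type.
Notation bool14 := (bool3 * bool3 * bool3 * bool3 * (bool * bool))%type.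

Inductive idx := I1 | I2 | I3.

Definition unit3 (k : idx) : bool3 :=
  match k with
  | I1 => (true, false, false) | I2 => (false, true, false) | I3 => (false, false, true)
  end.

Definition get3 (k : idx) (x : bool3) : bool :=
  let: (x1, x2, x3) := x in match k with I1 => x1 | I2 => x2 | I3 => x3 end.

(** Exponent of z_123 produced when b_k passes a_1^x1 a_2^x2 a_3^x3: with l < m the other two
    indices, passing a_l leaves p_kl, which must then pass a_m. *)
Definition opp_prod (k : idx) (x : bool3) : bool :=
  let: (x1, x2, x3) := x in
  match k with I1 => x2 && x3 | I2 => x1 && x3 | I3 => x1 && x2 end.

(** Exponent of t_123 produced when the factors p_kl left by b_k pass b_1^y1 b_2^y2 b_3^y3: p_kl
    commutes with every b except that of the third index. *)
Definition opp_det (k : idx) (x y : bool3) : bool :=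
  let: (x1, x2, x3) := x in let: (y1, y2, y3) := y in
  match k with
  | I1 => (x2 && y3) (+) (x3 && y2)
  | I2 => (x1 && y3) (+) (x3 && y1)
  | I3 => (x1 && y2) (+) (x2 && y1)
  end.

(* Coordinate [k] of the [u], [v] and [p] blocks stands for the pair
   of indices complementary to [k]. *)
Definition opp_below (k : idx) (x : bool3) : bool3 :=
  let: (x1, x2, _) := x in
  match k with
  | I1 => (false, false, false)
  | I2 => (false, false, x1)
  | I3 => (x2, x1, false)
  end.

Definition opp_others (k : idx) (x : bool3) : bool3 :=
  let: (x1, x2, x3) := x in
  match k with
  | I1 => (false, x3, x2)
  | I2 => (x3, false, x1)
  | I3 => (x2, x1, false)
  end.

Definition scale3 (k : bool) (x : bool3) : bool3 :=
  if k then x else (false, false, false).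

Notation zero3 := (false, false, false).

Definition vec_a2 (x : bool3) : bool14 := (x, zero3, zero3, zero3, (false, false)).
Definition vec_b2 (x : bool3) : bool14 := (zero3, x, zero3, zero3, (false, false)).
Definition vec_u (x : bool3) : bool14 := (zero3, zero3, x, zero3, (false, false)).
Definition vec_v (x : bool3) : bool14 := (zero3, zero3, zero3, x, (false, false)).
Definition vec_zt (z t : bool) : bool14 := (zero3, zero3, zero3, zero3, (z, t)).

(* The word [c a1^x1 a2^x2 a3^x3 b1^y1 b2^y2 b3^y3 p23^p1 p13^p2 p12^p3], with [c]
   a product of the 14 central involutions. *)
Definition nf := (bool14 * (bool3 * bool3 * bool3))%type.

Inductive letter := LA of idx | LB of idx | LP of idx | LC of bool14.

Definition carry_a (k : idx) (x : bool3) : bool14 :=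
  (vec_a2 (scale3 (get3 k x) (unit3 k)) + vec_u (opp_below k x))%R.
Definition carry_b (k : idx) (x : bool3) : bool14 :=
  (vec_b2 (scale3 (get3 k x) (unit3 k)) + vec_v (opp_below k x))%R.

(** Left multiplication by one letter. For [LB k], b_k passes the a-block and leaves the factors
    p_kl, these pass the b-block, and only then is b_k sorted into the b-block. *)
Definition step (l : letter) (n : nf) : nf :=
  let: (c, (x, y, p)) := n in
  match l with
  | LA k => (c + carry_a k x, (x + unit3 k, y, p))%R
  | LB k => (c + (carry_b k y + vec_zt (opp_prod k x) (opp_det k x y)),
             (x, y + unit3 k, p + opp_others k x))%R
  | LP k => (c + vec_zt (get3 k x) (get3 k y), (x, y, p + unit3 k))%R
  | LC v => (c + v, (x, y, p))%R
  end.

Section Collection.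

Variables (gT : finGroupType) (fa fb fp : idx -> gT) (fc : bool14 -> gT).

Definition third k l :=
  match k, l with
  | I1, I2 | I2, I1 => I3 | I1, I3 | I3, I1 => I2 | _, _ => I1
  end.

Definition descent (k l : idx) :=
  match k, l with I2, I1 | I3, I1 | I3, I2 => true | _, _ => false end.

Definition idx_neq (k l : idx) :=
  match k, l with I1, I1 | I2, I2 | I3, I3 => false | _, _ => true end.

(** The rewriting rules carry a tail [X], so they apply inside right-nested products. The rules for
    two a's or two b's are limited to descents, so that they only sort. *)
Hypothesis fc0 : fc 0%R = 1.
Hypothesis fc_fc : forall v w X, fc v * (fc w * X) = fc (v + w)%R * X.
Hypothesis mul_fc : forall y v X, y * (fc v * X) = fc v * (y * X).
Hypothesis faS : forall k X, fa k * (fa k * X) = fc (vec_a2 (unit3 k)) * X.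
Hypothesis fbS : forall k X, fb k * (fb k * X) = fc (vec_b2 (unit3 k)) * X.
Hypothesis fpS : forall k X, fp k * (fp k * X) = X.
Hypothesis faC : forall k l X, descent k l ->
  fa k * (fa l * X) = fc (vec_u (unit3 (third k l))) * (fa l * (fa k * X)).
Hypothesis fbC : forall k l X, descent k l ->
  fb k * (fb l * X) = fc (vec_v (unit3 (third k l))) * (fb l * (fb k * X)).
Hypothesis fb_fa : forall k X, fb k * (fa k * X) = fa k * (fb k * X).
Hypothesis fb_faC : forall k l X, idx_neq k l ->
  fb k * (fa l * X) = fa l * (fb k * (fp (third k l) * X)).
Hypothesis fp_fa : forall k l X, idx_neq k l -> fp k * (fa l * X) = fa l * (fp k * X).
Hypothesis fp_fb : forall k l X, idx_neq k l -> fp k * (fb l * X) = fb l * (fp k * X).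
Hypothesis fp_faS : forall k X,
  fp k * (fa k * X) = fc (vec_zt true false) * (fa k * (fp k * X)).
Hypothesis fp_fbS : forall k X,
  fp k * (fb k * X) = fc (vec_zt false true) * (fb k * (fp k * X)).
Hypothesis fp_fpC : forall k l X, fp k * (fp l * X) = fp l * (fp k * X).

Definition block (f : idx -> gT) (x : bool3) (X : gT) : gT :=
  let: (x1, x2, x3) := x in
  pw _ 1 (f I1) x1 * (pw _ 1 (f I2) x2 * (pw _ 1 (f I3) x3 * X)).

Definition nfval (n : nf) : gT :=
  let: (c, (x, y, p)) := n in fc c * block fa x (block fb y (block fp p 1)).

Definition letval (l : letter) : gT :=
  match l with LA k => fa k | LB k => fb k | LP k => fp k | LC v => fc v end.

Lemma fa_block k x X : fa k * block fa x X = fc (carry_a k x) * block fa (x + unit3 k)%R X.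
Proof.
(* A leading [fc 0] provides the accumulator into which [fc_fc] merges the central factors; the same
   device recurs below. *)
rewrite -[LHS]mul1g -fc0.
have R := (fc_fc, faC I2 I1 _ isT, faC I3 I1 _ isT, faC I3 I2 _ isT, faS, mul_fc).
by case: k x => [] [[[] []] []]; rewrite /block /= ?mul1g ?R.
Qed.

Lemma fb_block k x X : fb k * block fb x X = fc (carry_b k x) * block fb (x + unit3 k)%R X.
Proof.
rewrite -[LHS]mul1g -fc0.
have R := (fc_fc, fbC I2 I1 _ isT, fbC I3 I1 _ isT, fbC I3 I2 _ isT, fbS, mul_fc).
by case: k x => [] [[[] []] []]; rewrite /block /= ?mul1g ?R.
Qed.

Lemma fp_block k x X : fp k * block fp x X = block fp (x + unit3 k)%R X.
Proof.
have R := (fp_fpC I2 I1, fp_fpC I3 I1, fp_fpC I3 I2, fpS).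
by case: k x => [] [[[] []] []]; rewrite /block /= ?mul1g ?R.
Qed.

Lemma fp_fb_block k y X :
  fp k * block fb y X = fc (vec_zt false (get3 k y)) * block fb y (fp k * X).
Proof.
rewrite -[LHS]mul1g -fc0.
have R := (fc_fc, fp_fb I1 I2 _ isT, fp_fb I1 I3 _ isT, fp_fb I2 I1 _ isT,
  fp_fb I2 I3 _ isT, fp_fb I3 I1 _ isT, fp_fb I3 I2 _ isT, fp_fbS, mul_fc).
by case: k y => [] [[[] []] []]; rewrite /block /= ?mul1g ?R.
Qed.

Lemma fp_fa_block k x X :
  fp k * block fa x X = fc (vec_zt (get3 k x) false) * block fa x (fp k * X).
Proof.
rewrite -[LHS]mul1g -fc0.
have R := (fc_fc, fp_fa I1 I2 _ isT, fp_fa I1 I3 _ isT, fp_fa I2 I1 _ isT,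
  fp_fa I2 I3 _ isT, fp_fa I3 I1 _ isT, fp_fa I3 I2 _ isT, fp_faS, mul_fc).
by case: k x => [] [[[] []] []]; rewrite /block /= ?mul1g ?R.
Qed.

Lemma fb_fa_block k x X :
  fb k * block fa x X =
  fc (vec_zt (opp_prod k x) false) * block fa x (fb k * block fp (opp_others k x) X).
Proof.
rewrite -[LHS]mul1g -fc0.
have R := (fc_fc, fb_fa, fb_faC I1 I2 _ isT, fb_faC I1 I3 _ isT, fb_faC I2 I1 _ isT,
  fb_faC I2 I3 _ isT, fb_faC I3 I1 _ isT, fb_faC I3 I2 _ isT,
  fp_fa I1 I3 _ isT, fp_fa I2 I3 _ isT, fp_fa I3 I2 _ isT, fp_faS, mul_fc).
by case: k x => [] [[[] []] []]; rewrite /block /= ?mul1g ?R /= ?R.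
Qed.

Lemma mul_fc_block f x v X : block f x (fc v * X) = fc v * block f x X.
Proof. by case: x => [[x1 x2] x3]; rewrite /block !mul_fc. Qed.

Lemma blockE f x1 x2 x3 X :
  block f (x1, x2, x3) X =
  pw _ 1 (f I1) x1 * (pw _ 1 (f I2) x2 * (pw _ 1 (f I3) x3 * X)).
Proof. by []. Qed.

Lemma fp_block_fb_block k x y X :
  block fp (opp_others k x) (block fb y X) =
  fc (vec_zt false (opp_det k x y)) * block fb y (block fp (opp_others k x) X).
Proof.
rewrite -[LHS]mul1g -fc0.
have R := (fc_fc, fp_fb_block, mul_fc).
(* The determinant is the inner product of [opp_others k x] with y: coordinate m of the p-block
   meets only b_m nontrivially. *)
have -> : opp_det k x y = let: (o1, o2, o3) := opp_others k x in
  (o1 && get3 I1 y) (+) ((o2 && get3 I2 y) (+) (o3 && get3 I3 y)).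
  by case: k x y => [] [[[] []] []] [[[] []] []].
case: (opp_others k x) => [[o1 o2] o3]; rewrite !blockE.
by case: o1 o2 o3 => [] [] []; rewrite /pw ?mul1g ?R; congr (fc _ * _);
  case: y => [[[] []] []].
Qed.

Lemma fp_block_block x p :
  block fp x (block fp p 1) = block fp (p + x)%R 1.
Proof.
case: x => [[x1 x2] x3]; rewrite blockE.
by case: x1 x2 x3 => [] [] []; rewrite /pw ?mul1g ?fp_block; case: p => [[[] []] []].
Qed.

Lemma vec_ztE z t : vec_zt z t = (vec_zt z false + vec_zt false t)%R.
Proof. by case: z t => [] []. Qed.

Lemma step_correct l n : letval l * nfval n = nfval (step l n).
Proof.
case: n => c [[x y] p]; case: l => [k|k|k|v]; rewrite /nfval /letval /step mul_fc.
- by rewrite fa_block fc_fc.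
- rewrite fb_fa_block fp_block_fb_block (mul_fc (fb k)) fb_block fp_block_block.
  rewrite !mul_fc_block !fc_fc [vec_zt (opp_prod k x) (opp_det k x y)]vec_ztE.
  by rewrite [(carry_b k y + _)%R]GRing.addrC !GRing.addrA.
- by rewrite fp_fa_block fp_fb_block fp_block mul_fc_block !fc_fc -GRing.addrA -vec_ztE.
- by rewrite -mul_fc fc_fc GRing.addrC.
Qed.

End Collection.

(** * The rewriting rules in G_3 *)

Section NormalForm.

Variables (gT : finGroupType) (a b : 'I_3 -> gT).
Hypothesis rel : G3_relations a b.

Definition ia (k : idx) := match k with I1 => a i1 | I2 => a i2 | I3 => a i3 end.
Definition ib (k : idx) := match k with I1 => b i1 | I2 => b i2 | I3 => b i3 end.
Definition ip (k : idx) :=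
  match k with I1 => [~ a i2, b i3] | I2 => [~ a i1, b i3] | I3 => [~ a i1, b i2] end.
Definition iu (k : idx) :=
  match k with I1 => [~ a i2, a i3] | I2 => [~ a i1, a i3] | I3 => [~ a i1, a i2] end.
Definition iv (k : idx) :=
  match k with I1 => [~ b i2, b i3] | I2 => [~ b i1, b i3] | I3 => [~ b i1, b i2] end.
Definition z123 := [~ ip I3, a i3].
Definition t123 := [~ ip I3, b i3].

Definition cgens := [:: ia I1 ^+ 2; ia I2 ^+ 2; ia I3 ^+ 2;
  ib I1 ^+ 2; ib I2 ^+ 2; ib I3 ^+ 2; iu I1; iu I2; iu I3; iv I1; iv I2; iv I3; z123; t123].

Definition seq14 (v : bool14) : seq bool :=
  let: ((x1, x2, x3), (y1, y2, y3), (u1, u2, u3), (v1, v2, v3), (z, t)) := v in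
  [:: x1; x2; x3; y1; y2; y3; u1; u2; u3; v1; v2; v3; z; t].

Definition cen (v : bool14) : gT := invprod gT mulg 1 cgens (seq14 v).

Local Notation cinv := (central_inv gT mulg 1).

Lemma sqgE (x : gT) : x ^+ 2 = x * x.
Proof. by rewrite expgS expg1. Qed.

Lemma group_cinv (c : gT) : central c -> c ^+ 2 = 1 -> cinv c.
Proof.
move=> hc c2; split=> [|x|x y|x y].
- by rewrite -sqgE.
- by rewrite (hc x).
- by rewrite mulgA.
- by rewrite !mulgA (hc x).
Qed.

(** With p = [x, y], x p is the conjugate x^y, so (x p)^2 = (x^2)^y = x^2. Hence p x p = x, and p is
    an involution. *)
Lemma commute_sq_central (x y : gT) :
  central (x ^+ 2) -> [~ x, y] ^+ 2 = 1 -> commute [~ x, y] x.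
Proof.
move=> hx hp; have hpV : [~ x, y]^-1 = [~ x, y].
  by apply/eqP; rewrite eq_invg_mul -sqgE hp.
have h : (x * [~ x, y]) ^+ 2 = x ^+ 2.
  by rewrite commgEl mulKVg -conjXg conjgE (hx y) mulKg.
move: h hp {hpV}; rewrite !sqgE /commute; move: [~ x, y] => p.
rewrite -!mulgA => /mulgI h hp.
by apply: (mulIg p); rewrite -!mulgA hp mulg1 h.
Qed.

Lemma invg_invol (x : gT) : x ^+ 2 = 1 -> x^-1 = x.
Proof. by move=> hx; apply/eqP; rewrite eq_invg_mul -sqgE hx. Qed.

Lemma p_sym i j : i != j -> [~ a i, b j] = [~ a j, b i] /\ [~ a i, b j] ^+ 2 = 1.
Proof.
case: rel => _ [[_ _ _ h] _]; rewrite neq_ltn => /orP[] ij; first exact: h.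
by case: (h _ _ ij) => <-.
Qed.

Lemma p_inv i j : i != j -> [~ b j, a i] = [~ a i, b j].
Proof. by move/p_sym=> [_ h]; rewrite -invg_comm invg_invol. Qed.

Lemma p_comm_outer i j : i != j ->
  commute [~ a i, b j] (a i) /\ commute [~ a i, b j] (b j).
Proof.
case: rel => _ [[h _ _ _] _] ij; have [_ h2] := p_sym _ _ ij.
have [_ [ha _]] := h i; have [_ [_ hb]] := h j.
split; first exact: commute_sq_central.
by rewrite -p_inv //; apply: commute_sq_central; rewrite ?p_inv.
Qed.

Lemma p_comm i j : i != j ->
  [/\ commute [~ a i, b j] (a i), commute [~ a i, b j] (a j),
      commute [~ a i, b j] (b i) & commute [~ a i, b j] (b j)].
Proof.
move=> ij; have [h1 h2] := p_comm_outer i j ij.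
have [|h3 h4] := p_comm_outer j i; first by rewrite eq_sym.
by rewrite -(p_sym i j ij).1 in h3 h4.
Qed.

Lemma ab_comm i : commute (b i) (a i).
Proof. by case: rel => _ [[h _ _ _] _]; apply/commute_sym/commgP/eqP; case: (h i). Qed.

Lemma all_cinv_cgens : all_cinv gT mulg 1 cgens.
Proof.
have [h4 [[h1 h2 h3 _] [_ h8]]] := rel.
have ha k : central (ia k ^+ 2) /\ central (ib k ^+ 2).
  by case: k; rewrite /ia /ib; [case: (h1 i1)|case: (h1 i2)|case: (h1 i3)].
have ha2 k : (ia k ^+ 2) ^+ 2 = 1 /\ (ib k ^+ 2) ^+ 2 = 1.
  by rewrite -!expgM; case: k; rewrite /ia /ib;
    [case: (h4 i1)|case: (h4 i2)|case: (h4 i3)].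
have hu k : central (iu k) /\ central (iv k) by case: k; apply: h3.
have hu2 k : iu k ^+ 2 = 1 /\ iv k ^+ 2 = 1.
  by case: k; [case: (h2 i2 i3)|case: (h2 i1 i3)|case: (h2 i1 i2)].
have [z2 t2 zC tC] := h8 i1 i2 i3 isT.
have H c : central c -> c ^+ 2 = 1 -> cinv c by apply: group_cinv.
by repeat (split; first by apply: H;
  [apply: (ha _).1 || apply: (ha _).2 || apply: (hu _).1 || apply: (hu _).2 || done |
   apply: (ha2 _).1 || apply: (ha2 _).2 || apply: (hu2 _).1 || apply: (hu2 _).2 || done]).
Qed.

Lemma cinv_cen v : cinv (cen v).
Proof. exact: (central_inv_invprod _ _ _ (@mul1g gT) (@mulg1 gT) _ _ all_cinv_cgens). Qed.

Lemma cenD v w : cen (v + w)%R = cen v * cen w.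
Proof.
rewrite /cen (invprodD _ _ _ (@mul1g gT) (@mulg1 gT)); last exact: all_cinv_cgens.
congr invprod; case: v => [[[[[[? ?] ?] [[? ?] ?]] [[? ?] ?]] [[? ?] ?]] [? ?]].
by case: w => [[[[[[? ?] ?] [[? ?] ?]] [[? ?] ?]] [[? ?] ?]] [? ?]].
Qed.

Lemma mul_cen y v X : y * (cen v * X) = cen v * (y * X).
Proof. by rewrite (cinvCA _ _ _ _ (cinv_cen v)). Qed.

Lemma cen_mul v w X : cen v * (cen w * X) = cen (v + w)%R * X.
Proof. by rewrite cenD mulgA. Qed.

Lemma cen0 : cen 0%R = 1.
Proof. by rewrite /cen /= !mulg1. Qed.

Lemma swapg (x y c X : gT) : [~ y, x] = c -> y * (x * X) = x * (y * (c * X)).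
Proof. by move=> <-; rewrite mulgA (commgC y x) -!mulgA. Qed.

Lemma commuteA (x y X : gT) : commute y x -> y * (x * X) = x * (y * X).
Proof. by move=> h; rewrite mulgA h mulgA. Qed.

Lemma iaS k X : ia k * (ia k * X) = cen (vec_a2 (unit3 k)) * X.
Proof. by rewrite mulgA -sqgE; congr (_ * X); case: k; rewrite /cen /= ?mul1g ?mulg1. Qed.
Lemma ibS k X : ib k * (ib k * X) = cen (vec_b2 (unit3 k)) * X.
Proof. by rewrite mulgA -sqgE; congr (_ * X); case: k; rewrite /cen /= ?mul1g ?mulg1. Qed.

Lemma cen_iu k : cen (vec_u (unit3 k)) = iu k.
Proof. by case: k; rewrite /cen /= ?mul1g ?mulg1. Qed.
Lemma cen_iv k : cen (vec_v (unit3 k)) = iv k.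
Proof. by case: k; rewrite /cen /= ?mul1g ?mulg1. Qed.
Lemma cen_z : cen (vec_zt true false) = z123.
Proof. by rewrite /cen /= ?mul1g ?mulg1. Qed.
Lemma cen_t : cen (vec_zt false true) = t123.
Proof. by rewrite /cen /= ?mul1g ?mulg1. Qed.

Lemma iaC (k l : idx) X : descent k l ->
  ia k * (ia l * X) = cen (vec_u (unit3 (third k l))) * (ia l * (ia k * X)).
Proof.
case: rel => _ [[_ h _ _] _] hkl; rewrite -!mul_cen; apply: swapg; rewrite cen_iu.
by case: k l hkl => [] [] // _; case: (h _ _ (isT : i1 < i2)%N) => //;
  case: (h _ _ (isT : i1 < i3)%N) => //; case: (h _ _ (isT : i2 < i3)%N).
Qed.

Lemma ibC (k l : idx) X : descent k l ->
  ib k * (ib l * X) = cen (vec_v (unit3 (third k l))) * (ib l * (ib k * X)).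
Proof.
case: rel => _ [[_ h _ _] _] hkl; rewrite -!mul_cen; apply: swapg; rewrite cen_iv.
by case: k l hkl => [] [] // _; case: (h _ _ (isT : i1 < i2)%N) => //;
  case: (h _ _ (isT : i1 < i3)%N) => //; case: (h _ _ (isT : i2 < i3)%N).
Qed.

Lemma ib_ia k X : ib k * (ia k * X) = ia k * (ib k * X).
Proof. by apply: commuteA; case: k; apply: ab_comm. Qed.

Lemma ib_iaC k l X : idx_neq k l -> ib k * (ia l * X) = ia l * (ib k * (ip (third k l) * X)).
Proof.
move=> hkl; apply: swapg.
by case: k l hkl => [] [] // _; rewrite /ia /ib /ip /= p_inv //; case: (@p_sym i1 i2 isT);
  case: (@p_sym i1 i3 isT); case: (@p_sym i2 i3 isT).
Qed.

Lemma ip_ia k l X : idx_neq k l -> ip k * (ia l * X) = ia l * (ip k * X).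
Proof.
move=> hkl; apply: commuteA; move: (@p_comm i1 i2 isT) (@p_comm i1 i3 isT) (@p_comm i2 i3 isT).
by case: k l hkl => [] [] // _ [] ? ? ? ? [] ? ? ? ? [] ? ? ? ?.
Qed.

Lemma ip_ib k l X : idx_neq k l -> ip k * (ib l * X) = ib l * (ip k * X).
Proof.
move=> hkl; apply: commuteA; move: (@p_comm i1 i2 isT) (@p_comm i1 i3 isT) (@p_comm i2 i3 isT).
by case: k l hkl => [] [] // _ [] ? ? ? ? [] ? ? ? ? [] ? ? ? ?.
Qed.

Lemma ip_iaS k X : ip k * (ia k * X) = cen (vec_zt true false) * (ia k * (ip k * X)).
Proof.
case: rel => _ [_ [h _]]; rewrite -!mul_cen; apply: swapg; rewrite cen_z.
case: k => //=; rewrite /z123 /ip /ia.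
  by case: (h i2 i3 i1 isT) => _ <-.
by case: (h i1 i2 i3 isT) => _ -> _ _; rewrite (@p_sym i3 i1 isT).1.
Qed.

Lemma ip_ibS k X : ip k * (ib k * X) = cen (vec_zt false true) * (ib k * (ip k * X)).
Proof.
case: rel => _ [_ [h _]]; rewrite -!mul_cen; apply: swapg; rewrite cen_t.
case: k => //=; rewrite /t123 /ip /ib.
  by case: (h i2 i3 i1 isT) => _ _ _ <-.
by case: (h i1 i2 i3 isT) => _ _ _ ->; rewrite (@p_sym i3 i1 isT).1.
Qed.

Lemma ipS k X : ip k * (ip k * X) = X.
Proof.
have hp i j : i != j -> [~ a i, b j] ^+ 2 = 1 by case/p_sym.
by rewrite mulgA -sqgE; case: k; rewrite hp // mul1g.
Qed.

Lemma commute_conj (x y v : gT) : x * y = v * (y * x) -> cinv v -> x ^ y = v * x.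
Proof. by move=> h hv; rewrite conjgE h -(cinvCA _ _ _ _ hv) mulKg. Qed.

(** Both y and its inverse occur once in [x, y], so p picks up v twice on its way through. *)
Lemma commute_twisted (p x y v : gT) : cinv v ->
  commute p x -> p * y = v * (y * p) -> commute p [~ x, y].
Proof.
move=> hv hx hy.
have vJ g : v ^ g = v by rewrite conjgE -(cinvC _ _ _ _ hv) mulKg.
have px : p ^ x = p by rewrite conjgE hx mulKg.
have py := commute_conj _ _ _ hy hv.
have pxV : p ^ x^-1 = p by rewrite -{1}px conjgK.
have vpy : (v * p) ^ y = p by rewrite conjMg vJ py mulgA (cinv_sq _ _ _ _ hv) mul1g.
have pyV : p ^ y^-1 = v * p by rewrite -{1}vpy conjgK.
have : p ^ [~ x, y] = p.
  have -> : [~ x, y] = x^-1 * (y^-1 * (x * y)) by [].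
  by rewrite !conjgM pxV pyV (conjMg v p x) vJ px.
by move/conjg_fixP/commgP.
Qed.

(** Of two distinct p's, one is written as a commutator of an a and a b such that the other p
    commutes with its first entry and commutes with the second up to z_123 or t_123. *)
Lemma ip_ipC k l X : ip k * (ip l * X) = ip l * (ip k * X).
Proof.
apply: commuteA.
have ha m : ip m * ia m = cen (vec_zt true false) * (ia m * ip m).
  by have := ip_iaS m 1; rewrite !mulg1.
have hb m : ip m * ib m = cen (vec_zt false true) * (ib m * ip m).
  by have := ip_ibS m 1; rewrite !mulg1.
have hpa k' l' : idx_neq k' l' -> commute (ip k') (ia l').
  by move=> h; have := ip_ia k' l' 1 h; rewrite !mulg1.
have hpb k' l' : idx_neq k' l' -> commute (ip k') (ib l').
  by move=> h; have := ip_ib k' l' 1 h; rewrite !mulg1.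
have h12 : commute (ip I1) (ip I2).
  rewrite -[ip I2]p_inv //; apply: commute_twisted (cinv_cen _) _ (ha I1).
  exact: (hpb I1 I3 isT).
have h13 : commute (ip I1) (ip I3).
  rewrite -[ip I3]p_inv //; apply: commute_twisted (cinv_cen _) _ (ha I1).
  exact: (hpb I1 I2 isT).
have h23 : commute (ip I2) (ip I3).
  apply: commute_twisted (cinv_cen _) _ (hb I2); exact: (hpa I2 I1 isT).
by case: k l => [] [] //; apply: commute_sym.
Qed.

Local Notation nv := (nfval gT ia ib ip cen).
Local Notation lv := (letval gT ia ib ip cen).

Lemma nv_step l n : lv l * nv n = nv (step l n).
Proof.
exact: (step_correct _ _ _ _ _ cen0 cen_mul mul_cen iaS ibS ipS iaC ibC ib_ia ib_iaC
  ip_ia ip_ib ip_iaS ip_ibS ip_ipC).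
Qed.

End NormalForm.

(** * The loop on F_2^3 x F_2^7 *)

Notation bool7 := (bool3 * bool3 * bool)%type.

(* The value lists the exponents of the squares of x1, x2, x3, of the commutators
   [x2, x3], [x1, x3], [x1, x2], and of the associator. *)
Definition theta (u v : bool3) : bool7 :=
  let: (u1, u2, u3) := u in let: (v1, v2, v3) := v in
  ((u1 && v1, u2 && v2, u3 && v3), (u3 && v2, u3 && v1, u2 && v1),
   (u3 && v1 && v2) (+) (((u1 && v2) (+) (u2 && v1)) && v3)).

Definition code_loop := (bool3 * bool7)%type.

Definition code_loop1 : code_loop := (0, 0)%R.
Definition clmul (p q : code_loop) : code_loop := (p.1 + q.1, p.2 + q.2 + theta p.1 q.1)%R.
Definition clld (p q : code_loop) : code_loop := (p.1 + q.1, p.2 + q.2 + theta p.1 (p.1 + q.1))%R.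
Definition clrd (q p : code_loop) : code_loop := (p.1 + q.1, p.2 + q.2 + theta (p.1 + q.1) p.1)%R.

Lemma bool3_add2 (u : bool3) : (u + u = 0)%R.
Proof. by case: u => [[[] []] []]. Qed.

Lemma bool7_add2 (x : bool7) : (x + x = 0)%R.
Proof. by case: x => [[u v] c]; rewrite -[LHS]/(u + u, v + v, c + c)%R !bool3_add2; case: c. Qed.

Lemma bool3_addK (u v : bool3) : (u + (u + v) = v)%R.
Proof. by rewrite GRing.addrA bool3_add2 GRing.add0r. Qed.

Lemma bool7_addK (x y : bool7) : (x + (x + y) = y)%R.
Proof. by rewrite GRing.addrA bool7_add2 GRing.add0r. Qed.

Lemma theta0u u : theta 0%R u = 0%R.
Proof. by case: u => [[[] []] []]. Qed.
Lemma thetau0 u : theta u 0%R = 0%R.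
Proof. by case: u => [[[] []] []]. Qed.

(** The part of the Moufang law for [clmul] that remains once the central coordinates, which enter
    both sides equally, are removed. *)
Lemma theta_moufang u v w :
  (theta u v + theta (u + v) u + theta (u + v + u) w =
   theta u w + theta v (u + w) + theta u (v + (u + w)))%R.
Proof. by case: u v w => [[[] []] []] [[[] []] []] [[[] []] []]. Qed.

Lemma clmulE u x v y : clmul (u, x) (v, y) = (u + v, x + y + theta u v)%R.
Proof. by []. Qed.

Lemma clldE u x v y : clld (u, x) (v, y) = (u + v, x + y + theta u (u + v))%R.
Proof. by []. Qed.

Lemma clrdE u x v y : clrd (v, y) (u, x) = (u + v, x + y + theta (u + v) u)%R.
Proof. by []. Qed.

Lemma cl_loop : is_loop clmul clld clrd code_loop1.
Proof.
split=> [[u x]|[u x] [v y]|[u x] [v y]]; rewrite /code_loop1.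
- by rewrite !clmulE !(GRing.add0r, GRing.addr0) theta0u thetau0 !GRing.addr0.
- split; [rewrite clldE clmulE | rewrite clmulE clldE];
    by rewrite !bool3_addK -!GRing.addrA !bool7_addK bool7_add2 GRing.addr0.
- split; [rewrite clrdE clmulE | rewrite clmulE clrdE].
    rewrite [(u + v + u)%R]GRing.addrC bool3_addK [(_ + x)%R]GRing.addrC -!GRing.addrA.
    by rewrite !bool7_addK bool7_add2 GRing.addr0.
  rewrite [(v + u)%R]GRing.addrC bool3_addK [(y + x)%R]GRing.addrC -!GRing.addrA.
  by rewrite bool7_addK bool7_add2 GRing.addr0.
Qed.

Lemma cl_moufang : moufang_law clmul (fun _ => True).
Proof.
move=> [u x] [v y] [w z] _ _ _; rewrite !clmulE; congr pair.
  by rewrite -!GRing.addrA.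
have lhs (V : zmodType) (p q r x' y' z' : V) :
    (x' + y' + p + x' + q + z' + r = x' + y' + x' + z' + (p + q + r))%R.
  by rewrite (ACl (1*2*4*6*(3*5*7)))%AC.
have rhs (V : zmodType) (p q r x' y' z' : V) :
    (x' + (y' + (x' + z' + p) + q) + r = x' + y' + x' + z' + (p + q + r))%R.
  by rewrite !GRing.addrA.
by rewrite lhs rhs theta_moufang.
Qed.

Local Notation clinv := (central_inv code_loop clmul code_loop1).

Lemma cl_central q : q.1 = 0%R -> clinv q.
Proof.
case: q => _ c /= ->; split=> [|[u x]|[u x] [v y]|[u x] [v y]];
  rewrite !clmulE ?(theta0u, thetau0, GRing.addr0, GRing.add0r) //.
- by rewrite bool7_add2.
- by rewrite GRing.addrC.
- by rewrite -!GRing.addrA.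
- by rewrite -!GRing.addrA (GRing.addrCA x).
Qed.

Lemma cl_ld_diag x : clld x x = code_loop1.
Proof. by case: x => u x; rewrite clldE bool3_add2 bool7_add2 thetau0 GRing.addr0. Qed.

(** Squares, commutators and associators have zero first coordinate, hence are central involutions;
    all nine identities say that some operation is trivial on such an element. *)
Lemma cl_identities : E_identities clmul clld code_loop1 (fun _ => True).
Proof.
have C1 x : clinv (lsq clmul x) by apply: cl_central; apply: bool3_add2.
have C2 x y : clinv (lcomm clmul clld x y).
  apply: cl_central; case: x y => [u x] [v y].
  rewrite /lcomm !clmulE clldE [(v + u)%R]GRing.addrC; exact: (bool3_add2 (u + v)%R).
have C3 x y z : clinv (lassoc clmul clld x y z).
  apply: cl_central; case: x y z => [u x] [v y] [w z].
  rewrite /lassoc !clmulE clldE -(GRing.addrA u v w); exact: (bool3_add2 (u + (v + w))%R).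
have S c : clinv c -> lsq clmul c = code_loop1 by case.
have K c y : clinv c -> lcomm clmul clld c y = code_loop1.
  by move=> hc; rewrite /lcomm (cinvC _ _ _ _ hc) cl_ld_diag.
have A c y z : clinv c -> lassoc clmul clld c y z = code_loop1.
  by move=> hc; rewrite /lassoc (cinvA _ _ _ _ hc) cl_ld_diag.
by move=> x y z t s _ _ _ _ _; do !split; auto.
Qed.

Lemma cl_E_loop : E_loop clmul clld clrd code_loop1.
Proof. by split; [apply: cl_loop | apply: cl_moufang | apply: cl_identities]. Qed.

(** * Transport of a loop structure along an injection *)

Section Transfer.

Variables (gT : finGroupType) (Q : Type) (op ldq rdq : Q -> Q -> Q) (e : Q).
Hypothesis HQ : E_loop op ldq rdq e.
Variables (M : {set gT}) (mul : gT -> gT -> gT) (phi : Q -> gT).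
Hypothesis phi_inj : injective phi.
Hypothesis phiP : forall m, reflect (exists q, m = phi q) (m \in M).
Hypothesis phiM : forall p q, mul (phi p) (phi q) = phi (op p q).
Hypothesis phi1 : phi e = 1.

Lemma phi_mem q : phi q \in M. Proof. by apply/phiP; exists q. Qed.

Lemma ldiv_phi p q : ldiv_on M mul (phi p) (phi q) = phi (ldq p q).
Proof.
case: HQ => [[_ hld _] _ _]; rewrite /ldiv_on; case: pickP => [m|].
  case/andP=> /phiP[r ->] /eqP; rewrite phiM => /phi_inj <- /=.
  by rewrite (hld p r).2.
by move/(_ (phi (ldq p q))); rewrite phi_mem phiM (hld p q).1 eqxx.
Qed.

Lemma transfer_moufang : moufang_loop_on M mul.
Proof.
case: HQ => [[he hld hrd] hm _]; split.
- by move=> _ _ /phiP[p ->] /phiP[q ->]; rewrite phiM phi_mem.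
- by rewrite -phi1 phi_mem.
- by move=> _ /phiP[p ->]; rewrite -phi1 !phiM !(he p).1 !(he p).2.
- move=> _ _ /phiP[p ->] /phiP[q ->]; split.
    exists (phi (ldq p q)); split=> [|_ [/phiP[r ->]]].
      by rewrite phi_mem phiM (hld p q).1.
    by rewrite phiM => /phi_inj <-; rewrite (hld p r).2.
  exists (phi (rdq q p)); split=> [|_ [/phiP[r ->]]].
    by rewrite phi_mem phiM (hrd p q).1.
  by rewrite phiM => /phi_inj <-; rewrite (hrd p r).2.
- by move=> _ _ _ /phiP[p ->] /phiP[q ->] /phiP[r ->]; rewrite !phiM hm.
Qed.

Lemma transfer_identities : E_identities mul (ldiv_on M mul) 1 (fun m => m \in M).
Proof.
case: HQ => _ _ hE _ _ _ _ _ /phiP[x ->] /phiP[y ->] /phiP[z ->] /phiP[t ->] /phiP[s ->].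
have [[h1 h2 h3] [[h4 h5 h6] [h7 h8 h9]]] := hE x y z t s I I I I I.
rewrite /lsq /lcomm /lassoc in h1 h2 h3 h4 h5 h6 h7 h8 h9 *.
by rewrite !(phiM, ldiv_phi) h1 h2 h3 h4 h5 h6 h7 h8 h9 phi1.
Qed.

Lemma transfer_generated (X : {set gT}) :
  (forall P : Q -> Prop, (forall p, phi p \in X -> P p) ->
     (forall p q, P p -> P q -> P (op p q)) ->
     (forall p q, P p -> P q -> P (ldq p q)) -> forall q, P q) ->
  loop_generated M mul X.
Proof.
move=> gen S _ XS SM Sld _; apply/subsetP=> _ /phiP[q ->].
apply: (gen (fun q => phi q \in S)) => [p /(subsetP XS) //|p r hp hr|p r hp hr].
  by rewrite -phiM SM.
apply: (Sld _ _ _ hp hr (phi_mem _)).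
by rewrite phiM; case: HQ => [[_ /(_ p r)[-> _]]].
Qed.

End Transfer.

(** * The loop M_3 *)

(* [(true, k)] stands for [a_k] and [(false, k)] for [b_k]. *)
Definition word := seq (bool * idx).

Definition letter_of (l : bool * idx) : letter := if l.1 then LA l.2 else LB l.2.

Definition nf0 : nf := (0, (0, 0, 0))%R.
Definition addc (v : bool14) (n : nf) : nf := (n.1 + v, n.2)%R.
Definition collect (w : word) : nf := foldr (step \o letter_of) nf0 w.

(** Since a_i^4 = b_i^4 = 1, inverses are cubes, and all words stay positive. *)
Definition winv (w : word) : word := rev (flatten [seq nseq 3 l | l <- w]).
Definition wsigma (w : word) : word := [seq (~~ l.1, l.2) | l <- w].
Definition wab_inv (k : idx) : word := nseq 3 (true, k) ++ nseq 3 (false, k).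
Definition wrho (w : word) : word :=
  flatten [seq if l.1 then [:: (false, l.2)] else wab_inv l.2 | l <- w].
Definition wrho2 (w : word) : word :=
  flatten [seq if l.1 then wab_inv l.2 else [:: (true, l.2)] | l <- w].
Definition wcomm (v w : word) : word := winv v ++ winv w ++ v ++ w.
Definition wM3mul (v w : word) : word := wrho (winv v) ++ w ++ wrho2 (winv v).

Definition gword (u : bool3) : word :=
  let: (u1, u2, u3) := u in
  nseq u1 (true, I1) ++ nseq u2 (true, I2) ++ nseq u3 (true, I3).
Definition mword (u : bool3) : word := winv (gword u) ++ wsigma (gword u).

(* [kappa u] is the central correction that turns [mword u] into the loop
   product [(x_1^u1 x_2^u2) x_3^u3]. *)
Definition kappa (u : bool3) : bool7 :=
  let: (u1, u2, u3) := u in (zero3, (u2 && u3, u1 && u3, u1 && u2), u1 && u2 && u3).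

(** The central part of M_3 is spanned by the elements a_i^2 b_i^2, u_ij v_ij and z_123 t_123, on
    which sigma acts trivially. *)
Definition vec7 (x : bool7) : bool14 := let: (s, k, c) := x in (s, s, k, k, (c, c)).
Definition unvec7 (v : bool14) : bool7 := let: (s, _, k, _, (c, _)) := v in (s, k, c).

(** The cocycle of the representatives [mword u] is [theta] plus the coboundary of [kappa], by
    collection for the 64 pairs. *)
Lemma M3mul_table u v :
  collect (wM3mul (mword u) (mword v)) =
  addc (vec7 (theta u v + kappa u + kappa v + kappa (u + v)))%R (collect (mword (u + v)%R)).
Proof. apply/eqP; move: u v; do 2 case=> [[[] []] []]; exact: (erefl true). Qed.

(** Replacing g by g l turns m = g^-1 sigma(g) into l^-1 m sigma(l). The equation says that the
    central discrepancy, a sum in characteristic 2, lies in the image of [vec7]; [unvec7] supplies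
    the preimage. *)
Lemma twisted_table u l :
  let n := collect (winv [:: l] ++ mword u ++ wsigma [:: l]) in
  let m := collect (mword (u + unit3 l.2)%R) in
  n = addc (vec7 (unvec7 (n.1 + m.1)%R)) m.
Proof. apply/eqP; case: u l => [[[] []] []] [[] []]; exact: (erefl true). Qed.

(* Central words [h] such that the elements [h^-1 * sigma h] generate the centre
   of M_3. *)
Definition hword (j : 'I_7) : word :=
  nth [::] [:: [:: (true, I1); (true, I1)]; [:: (true, I2); (true, I2)];
    [:: (true, I3); (true, I3)];
    wcomm [:: (true, I2)] [:: (true, I3)]; wcomm [:: (true, I1)] [:: (true, I3)];
    wcomm [:: (true, I1)] [:: (true, I2)];
    wcomm (wcomm [:: (true, I1)] [:: (false, I2)]) [:: (true, I3)]] j.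

Definition unit7 (j : 'I_7) : bool7 :=
  nth 0%R [:: (unit3 I1, 0, false); (unit3 I2, 0, false); (unit3 I3, 0, false);
    (0, unit3 I1, false); (0, unit3 I2, false); (0, unit3 I3, false); (0, 0, true)]%R j.

Lemma hword_table j :
  let c := winv (hword j) ++ wsigma (hword j) in
  [/\ (collect (hword j)).2 = 0%R, collect c = (vec7 (unit7 j), 0)%R,
      (collect (wrho c)).2 = 0%R & collect (wrho c ++ wrho2 c) = collect c].
Proof. by case: j => [[|[|[|[|[|[|[|//]]]]]]] ?]; vm_compute. Qed.

Lemma vec7D x y : vec7 (x + y)%R = (vec7 x + vec7 y)%R.
Proof.
by case: x y => [[[[x1 x2] x3] [[k1 k2] k3]] c] [[[[y1 y2] y3] [[l1 l2] l3]] d].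
Qed.

Lemma vec7_inj : injective vec7.
Proof. by apply: (can_inj (g := unvec7)) => [[[s k] c]]. Qed.

(** * Coordinates on M_3 *)

Section Triality.

Variables (gT : finGroupType) (a b : 'I_3 -> gT) (sigma rho : gT -> gT).
Hypothesis gen : <<G3_gens a b>> = [set: gT].
Hypothesis rel : G3_relations a b.
Hypothesis card : #|[set: gT]| = (2 ^ 23)%N.
Hypothesis sigmaM : forall x y, sigma (x * y) = sigma x * sigma y.
Hypothesis rhoM : forall x y, rho (x * y) = rho x * rho y.
Hypothesis sigma_gens : forall i, sigma (a i) = b i /\ sigma (b i) = a i.
Hypothesis rho_gens : forall i, rho (a i) = b i /\ rho (b i) = (a i)^-1 * (b i)^-1.

Local Notation nv := (nfval gT (ia gT a) (ib gT b) (ip gT a b) (cen gT a b)).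
Local Notation lv := (letval gT (ia gT a) (ib gT b) (ip gT a b) (cen gT a b)).
Local Notation cen := (cen gT a b).
Local Notation cinv := (central_inv gT mulg 1).

Definition glet (l : bool * idx) : gT := if l.1 then ia gT a l.2 else ib gT b l.2.
Definition eval (w : word) : gT := foldr (fun l X => glet l * X) 1 w.

Lemma eval_cons l w : eval (l :: w) = glet l * eval w. Proof. by []. Qed.

Lemma eval_cat v w : eval (v ++ w) = eval v * eval w.
Proof. by elim: v => [|l v IH] /=; rewrite ?mul1g // IH mulgA. Qed.

Lemma eval_collect w : eval w = nv (collect w).
Proof.
elim: w => [|l w IH]; first by rewrite /= cen0 !mulg1.
rewrite eval_cons IH -[collect (l :: w)]/(step (letter_of l) (collect w)) -nv_step //.
by case: l => [[] k].
Qed.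

Lemma nv_addc v n : nv (addc v n) = nv n * cen v.
Proof.
case: n => c [[x y] p]; rewrite /addc /nfval cenD //.
have hc := cinv_cen _ _ _ rel v.
by rewrite -[LHS]mulgA -[RHS]mulgA (cinvC _ _ _ _ hc).
Qed.

Lemma glet_invE l : glet l ^+ 3 = (glet l)^-1.
Proof.
have [h4 _] := rel; apply: (mulIg (glet l)); rewrite mulVg -expgSr.
by case: l => [[] []]; [case: (h4 i1)|case: (h4 i2)|case: (h4 i3)|
  case: (h4 i1)|case: (h4 i2)|case: (h4 i3)].
Qed.

Lemma eval_winv w : eval (winv w) = (eval w)^-1.
Proof.
rewrite /winv; elim: w => [|l w IH]; first by rewrite invg1.
rewrite [map _ _]/= [flatten _]/= !rev_cons -!cats1 !eval_cat IH invMg -glet_invE.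
by rewrite /= !mulg1 -!mulgA !expgS expg0 mulg1.
Qed.

Lemma eval_wsigma w : eval (wsigma w) = sigma (eval w).
Proof.
elim: w => [|l w IH] /=.
  by apply: (mulgI (sigma 1)); rewrite -sigmaM !mulg1.
rewrite IH sigmaM; congr (_ * _); case: l => [[] k]; rewrite /glet /=.
  by case: k; rewrite (sigma_gens _).1.
by case: k; rewrite (sigma_gens _).2.
Qed.

Lemma eval_wab_inv k : eval (wab_inv k) = (ia gT a k)^-1 * (ib gT b k)^-1.
Proof.
by rewrite eval_cat -(glet_invE (true, k)) -(glet_invE (false, k)) /= !expgS !expg0 !mulg1.
Qed.

Lemma rho1 : rho 1 = 1. Proof. by apply: (mulgI (rho 1)); rewrite -rhoM !mulg1. Qed.
Lemma rhoV x : rho x^-1 = (rho x)^-1.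
Proof. by apply: (mulgI (rho x)); rewrite -rhoM !mulgV rho1. Qed.

Lemma rho_ia k : rho (ia gT a k) = ib gT b k.
Proof. by case: k; rewrite (rho_gens _).1. Qed.
Lemma rho_ib k : rho (ib gT b k) = (ia gT a k)^-1 * (ib gT b k)^-1.
Proof. by case: k; rewrite (rho_gens _).2. Qed.

Lemma eval_wrho w : eval (wrho w) = rho (eval w).
Proof.
rewrite /wrho; elim: w => [|l w IH]; first by rewrite rho1.
rewrite [map _ _]/= [flatten _]/= eval_cat IH eval_cons rhoM; congr (_ * _).
by case: l => [[] k]; [rewrite /= mulg1 [RHS]rho_ia | rewrite [LHS]eval_wab_inv [RHS]rho_ib].
Qed.

Lemma eval_wrho2 w : eval (wrho2 w) = rho (rho (eval w)).
Proof.
rewrite /wrho2; elim: w => [|l w IH]; first by rewrite !rho1.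
rewrite [map _ _]/= [flatten _]/= eval_cat IH eval_cons !rhoM; congr (_ * _).
case: l => [[] k]; first by rewrite [LHS]eval_wab_inv [X in rho X]rho_ia rho_ib.
by rewrite /= mulg1 [X in rho X]rho_ib rhoM !rhoV rho_ia rho_ib invMg !invgK mulKg.
Qed.

Lemma eval_wM3mul v w : eval (wM3mul v w) = M3mul rho (eval v) (eval w).
Proof. by rewrite !eval_cat eval_wrho eval_wrho2 eval_winv mulgA. Qed.

Lemma ord3P (i : 'I_3) : [\/ i = i1, i = i2 | i = i3].
Proof.
case: i => [[|[|[|//]]] hi]; [apply: Or31|apply: Or32|apply: Or33]; exact: val_inj.
Qed.

Lemma eval_surj g : exists w, g = eval w.
Proof.
have : g \in <<G3_gens a b>> by rewrite gen inE.
case/gen_prodgP=> n [c hc ->]; elim: n c hc => [|n IH] c hc.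
  by exists [::]; rewrite big_ord0.
have [w hw] := IH (fun i => c (lift ord0 i)) (fun i => hc _).
have [l hl] : exists l, c ord0 = glet l.
  have /setUP[] := hc ord0 => /imsetP[i _ ->].
    by case: (ord3P i) => ->; [exists (true, I1)|exists (true, I2)|exists (true, I3)].
  by case: (ord3P i) => ->; [exists (false, I1)|exists (false, I2)|exists (false, I3)].
by exists (l :: w); rewrite big_ord_recl hw hl.
Qed.

Lemma nv_inj : injective nv.
Proof.
have sur : nv @: [set: nf] = [set: gT].
  apply/eqP; rewrite eqEsubset subsetT; apply/subsetP=> g _.
  by have [w ->] := eval_surj g; rewrite eval_collect imset_f ?inE.
have /imset_injP h : #|nv @: [set: nf]| == #|[set: nf]|.
  by rewrite sur card cardsT !card_prod !card_bool; apply/eqP; rewrite !expnS -!mulnA.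
by move=> n m; apply: h; rewrite inE.
Qed.

Definition phi (q : code_loop) : gT := eval (mword q.1) * cen (vec7 (q.2 + kappa q.1)%R).

Lemma phiE q : phi q = nv (addc (vec7 (q.2 + kappa q.1)%R) (collect (mword q.1))).
Proof. by rewrite nv_addc -eval_collect. Qed.

Lemma phi_inj : injective phi.
Proof.
move=> [u x] [v y]; rewrite !phiE => /nv_inj h.
have mwordE w : (collect (mword w)).2.1.1 = w by case: w => [[[] []] []].
have uv : u = v by move: (congr1 (fun n : nf => n.2.1.1) h); rewrite /= !mwordE.
rewrite -uv in h *; congr pair.
by move: h => /(congr1 fst) /GRing.addrI /vec7_inj /GRing.addIr.
Qed.

Lemma cen_inj_word w v : collect w = (v, 0)%R -> eval w = cen v.
Proof. by move=> h; rewrite eval_collect h /= !mulg1. Qed.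

Lemma cinv_word w : (collect w).2 = 0%R -> cinv (eval w).
Proof.
case E: (collect w) => [v n] /= n0; rewrite n0 in E.
by rewrite (cen_inj_word _ _ E); apply: cinv_cen.
Qed.

(** For a central involution c, the last clause is the triality identity c rho(c) rho^2(c) = 1. *)
Definition central_diff (c : gT) :=
  [/\ exists2 h, cinv h & c = h^-1 * sigma h, cinv (rho c) & rho c * rho (rho c) = c].

Lemma central_diff1 : central_diff 1.
Proof.
have h1 := central_inv1 _ _ _ (@mul1g gT) (@mulg1 gT).
split; rewrite ?rho1 ?mulg1 //; exists 1 => //.
by have := eval_wsigma [::]; rewrite /= => <-; rewrite mulg1 invg1.
Qed.

Lemma central_diffM c d : central_diff c -> central_diff d -> central_diff (c * d).
Proof.
case=> [[h hh hc] rc ec] [[k hk hd] rd ed].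
have cM := central_invM _ _ _ (@mulg1 gT).
split; first 1 last.
- by rewrite rhoM; apply: cM.
- rewrite !rhoM -{3}ec -{3}ed -[LHS]mulgA -[RHS]mulgA; congr (_ * _).
  exact/esym/(cinvCA _ _ _ _ rd).
exists (h * k); first exact: cM.
have kV : k^-1 = k by apply: invg_invol; rewrite sqgE (cinv_sq _ _ _ _ hk).
rewrite hc hd sigmaM invMg kV -[LHS]mulgA -[RHS]mulgA.
by rewrite (cinvCA _ _ _ _ hk) (cinvCA _ _ _ _ hk).
Qed.

Lemma central_diff_vec7 x : central_diff (cen (vec7 x)).
Proof.
have base j : central_diff (cen (vec7 (unit7 j))).
  have [hh hc hr hs] := hword_table j; rewrite -(cen_inj_word _ _ hc); split.
  - by exists (eval (hword j)); [apply: cinv_word | rewrite eval_cat eval_winv eval_wsigma].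
  - by rewrite -eval_wrho; apply: cinv_word.
  by rewrite -eval_wrho2 -eval_wrho -eval_cat eval_collect hs -eval_collect.
pose bits := let: ((s1, s2, s3), (k1, k2, k3), c) := x in [:: s1; s2; s3; k1; k2; k3; c].
have -> : x = (\sum_(j < 7) if nth false bits j then unit7 j else 0)%R.
  rewrite !big_ord_recl big_ord0 {}/bits.
  by case: x => [[[[[] []] []] [[[] []] []]] []].
elim/big_ind: _ => [|y z hy hz|j _]; last case: ifP => // _.
- by rewrite (cen0 _ _ _ : cen (vec7 0%R) = 1); apply: central_diff1.
- by rewrite vec7D cenD //; apply: central_diffM.
- by rewrite (cen0 _ _ _ : cen (vec7 0%R) = 1); apply: central_diff1.
Qed.

(** The two outer factors of the product contribute rho(c) and rho^2(c), whose product is c. *)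
Lemma M3mul_central (x y c d : gT) : central_diff c -> cinv c -> cinv d ->
  M3mul rho (x * c) (y * d) = M3mul rho x y * (c * d).
Proof.
case=> _ rc ec hc hd; rewrite /M3mul.
have rrc : rho (rho c) = rho c * c by rewrite -[X in _ = _ * X]ec (cinvK _ _ _ (@mul1g gT)).
have rrcC := central_invM _ _ _ (@mulg1 gT) _ _ rc hc; rewrite -rrc in rrcC.
have cV : c^-1 = c by apply: invg_invol; rewrite sqgE (cinv_sq _ _ _ _ hc).
rewrite invMg cV !rhoM rrc.
rewrite !(cinvA _ _ _ _ rc) (cinvCA _ _ _ _ rc).
rewrite (cinvK _ _ _ (@mul1g gT)) // (cinvCA _ _ _ _ hc).
rewrite [RHS](cinvCA _ _ _ _ hc); congr (_ * _).
by rewrite -!mulgA; congr (_ * (_ * _)); rewrite (cinvC _ _ _ _ hd).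
Qed.

Lemma phi_mul p q : M3mul rho (phi p) (phi q) = phi (clmul p q).
Proof.
case: p q => [u x] [v y]; rewrite clmulE /phi.
have hv z := cinv_cen _ _ _ rel (vec7 z).
rewrite -[(u, x).1]/u -[(v, y).1]/v -[(u, x).2]/x -[(v, y).2]/y.
rewrite M3mul_central //; last exact: central_diff_vec7.
rewrite -eval_wM3mul eval_collect M3mul_table nv_addc -eval_collect -!cenD // -mulgA.
rewrite -[((u + v)%R, _).1]/(u + v)%R -[((u + v)%R, _).2]/(x + y + theta u v)%R.
rewrite -cenD // -!vec7D; congr (_ * cen (vec7 _)).
have -> : (theta u v + kappa u + kappa v + kappa (u + v) + (x + kappa u + (y + kappa v)) =
  x + y + theta u v + kappa (u + v) + ((kappa u + kappa u) + (kappa v + kappa v)))%R.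
  by rewrite [LHS](AC (4*(2*2)) (5*7*1*4*((2*6)*(3*8))))%AC.
by rewrite !bool7_add2 !GRing.addr0.
Qed.

Lemma phi1_loop : phi code_loop1 = 1.
Proof. by rewrite /phi [eval _]/= mul1g; apply: cen0. Qed.

(** Towards [phi], induction on a word for g with letters appended on the right, where
    [twisted_table] is the step. Conversely, the central part is h^-1 sigma(h) with h a central
    involution, so [gword u] times h is the required group element. *)
Lemma phiP m : reflect (exists q, m = phi q) (m \in M3 sigma).
Proof.
apply: (iffP imsetP) => [[g _ ->]|[q ->]].
  have [w ->] := eval_surj g; elim/last_ind: w => [|w l [[u x] IH]].
    exists code_loop1; rewrite phi1_loop; have := eval_wsigma [::] => /= <-.
    by rewrite invg1 mulg1.
  have ew : eval (rcons w l) = eval w * glet l by rewrite -cats1 eval_cat /= mulg1.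
  have sl : sigma (glet l) = eval (wsigma [:: l]) by rewrite eval_wsigma /= mulg1.
  have il : (glet l)^-1 = eval (winv [:: l]) by rewrite eval_winv /= mulg1.
  rewrite ew sigmaM invMg -!mulgA (mulgA _ (sigma _)) IH sl il.
  have hx := cinv_cen _ _ _ rel (vec7 (x + kappa u)%R).
  rewrite /phi -[(u, x).1]/u -[(u, x).2]/x -[(eval _ * cen _) * _]mulgA -(cinvC _ _ _ _ hx).
  rewrite mulgA mulgA -mulgA -eval_cat.
  rewrite mulgA -eval_cat -catA eval_collect twisted_table nv_addc -eval_collect.
  set y := unvec7 _; set v := (u + unit3 l.2)%R.
  exists (v, y + (x + kappa u) + kappa v)%R; rewrite -mulgA -cenD // -vec7D.
  by rewrite -[(v, _).1]/v -[(v, _).2]/(y + (x + kappa u) + kappa v)%R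
    -[in RHS]GRing.addrA bool7_add2 GRing.addr0.
case: q => u x; rewrite /phi -[(u, x).1]/u -[(u, x).2]/x.
have [[h hh ->] _ _] := central_diff_vec7 (x + kappa u)%R.
exists (eval (gword u) * h); first by rewrite inE.
have hV : h^-1 = h by apply: invg_invol; rewrite sqgE (cinv_sq _ _ _ _ hh).
rewrite eval_cat eval_winv eval_wsigma sigmaM invMg hV.
by rewrite (cinvA _ _ _ _ hh) !(cinvCA _ _ _ _ hh) !mulgA.
Qed.

Lemma phi_gen k : phi (unit3 k, 0)%R = (ia gT a k)^-1 * sigma (ia gT a k).
Proof.
have -> : phi (unit3 k, 0)%R = eval (mword (unit3 k)).
  rewrite /phi; have -> : vec7 ((unit3 k, 0).2 + kappa (unit3 k, 0).1)%R = 0%R.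
    by case: k.
  by rewrite cen0 mulg1.
by rewrite eval_cat eval_winv eval_wsigma; case: k; rewrite /= !mulg1.
Qed.

End Triality.

(* Reverses the commutator block, to match the order of [loop_cgens]. *)
Definition seq7 (x : bool7) : seq bool :=
  let: ((s1, s2, s3), (k1, k2, k3), c) := x in [:: s1; s2; s3; k3; k2; k1; c].

Lemma seq7D x y : seq7 (x + y)%R = xors (seq7 x) (seq7 y).
Proof.
by case: x y => [[[[x1 x2] x3] [[k1 k2] k3]] c] [[[[y1 y2] y3] [[l1 l2] l3]] d].
Qed.

(** * The homomorphism into an E-loop *)

Section Evaluation.

Variables (T : Type) (mul ld rd : T -> T -> T) (e : T).
Hypothesis EL : E_loop mul ld rd e.
Variables x1 x2 x3 : T.

Definition cl_eval (q : code_loop) : T :=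
  let: ((u1, u2, u3), x) := q in
  mul (invprod T mul e (loop_cgens T mul ld x1 x2 x3) (seq7 x)) (loop_rep T mul e x1 x2 x3 u1 u2 u3).

Lemma cl_evalM p q : cl_eval (clmul p q) = mul (cl_eval p) (cl_eval q).
Proof.
have el1 := el1x _ _ _ _ _ EL; have e1l := elx1 _ _ _ _ _ EL.
have hg := all_cinv_loop_cgens _ _ _ _ _ EL x1 x2 x3.
have hC x := central_inv_invprod _ _ _ el1 e1l _ (seq7 x) hg.
have hD x y := invprodD _ _ _ el1 e1l _ (seq7 x) (seq7 y) hg.
case: p q => [[[u1 u2] u3] x] [[[v1 v2] v3] y].
rewrite clmulE /cl_eval -[((u1, u2, u3) + _)%R]/(u1 (+) v1, u2 (+) v2, u3 (+) v3).
rewrite !seq7D -seq7D -hD seq7D -hD.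
rewrite [RHS](cinvA _ _ _ _ (hC x)) (cinvCA _ _ _ _ (hC y)) (loop_rep_mul _ _ _ _ _ EL).
by rewrite !(cinvA _ _ _ _ (hC _)).
Qed.

End Evaluation.

Definition code_gen (k : idx) : code_loop := (unit3 k, 0)%R.

(** The code loop is itself an E-loop, and each of its elements is a normal product in the three
    generators and their squares, commutators and associator, all of which are built with [clmul]
    and [clld]. *)
Lemma cl_generated (P : code_loop -> Prop) :
  (forall k, P (code_gen k)) ->
  (forall p q, P p -> P q -> P (clmul p q)) ->
  (forall p q, P p -> P q -> P (clld p q)) ->
  forall q, P q.
Proof.
move=> Pgen PM Pld.
have P0 : P code_loop1 by rewrite -(cl_ld_diag (code_gen I1)); apply: Pld.
have Ppw q k : P q -> P (pw code_loop code_loop1 q k) by case: k.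
have Pprod cs v : (forall n, P (nth code_loop1 cs n)) -> P (invprod code_loop clmul code_loop1 cs v).
  elim: cs v => [|c cs IH] [|k v] //= hcs; apply: PM; first exact: Ppw (hcs 0%N).
  by apply: IH => n; apply: (hcs n.+1).
pose cs := loop_cgens code_loop clmul clld (code_gen I1) (code_gen I2) (code_gen I3).
have Pcs n : P (nth code_loop1 cs n).
  by case: n => [|[|[|[|[|[|[|n]]]]]]]; rewrite /= ?nth_nil /lsq /lcomm /lassoc; auto 12.
case=> [[[u1 u2] u3] x].
have -> : (u1, u2, u3, x) = clmul (invprod code_loop clmul code_loop1 cs (seq7 x))
    (loop_rep code_loop clmul code_loop1 (code_gen I1) (code_gen I2) (code_gen I3) u1 u2 u3).
  have -> : invprod code_loop clmul code_loop1 cs (seq7 x) = (0, x)%R.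
    apply/eqP; case: x => [[[[x1 x2] x3] [[k1 k2] k3]] c].
    by case: x1 x2 x3 k1 k2 k3 c => [] [] [] [] [] [] [].
  have -> : loop_rep code_loop clmul code_loop1 (code_gen I1) (code_gen I2) (code_gen I3) u1 u2 u3
    = (u1, u2, u3, 0)%R by apply/eqP; case: u1 u2 u3 => [] [] [].
  by rewrite clmulE theta0u !GRing.addr0 GRing.add0r.
by apply: (PM); [apply: Pprod | do 2 (apply: (PM); last exact: (Ppw)); apply: (Ppw)].
Qed.

Theorem theorem4p5 (gT : finGroupType) (a b : 'I_3 -> gT) (sigma rho : gT -> gT) :
  (* G_3: nilpotent of class 3, generated by the a_i, b_i subject to (1)-(8),
     of order 2^23 *)
  nilpotent [set: gT] -> nil_class [set: gT] = 3 ->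
  <<G3_gens a b>> = [set: gT] ->
  G3_relations a b ->
  #|[set: gT]| = (2 ^ 23)%N ->
  (* the automorphisms sigma and rho *)
  (forall x y, sigma (x * y) = sigma x * sigma y) ->
  (forall x y, rho (x * y) = rho x * rho y) ->
  (forall i, sigma (a i) = b i /\ sigma (b i) = a i) ->
  (forall i, rho (a i) = b i /\ rho (b i) = (a i)^-1 * (b i)^-1) ->
  let M := M3 sigma in
  let mul := M3mul rho in
  let ld := ldiv_on M mul in
  let x i := (a i)^-1 * sigma (a i) in
  [/\ moufang_loop_on M mul,
      (* (1) *)
      loop_generated M mul
        [set x i1; x i2; x i3; lcomm mul ld (x i1) (x i2);
             lcomm mul ld (x i1) (x i3); lcomm mul ld (x i2) (x i3);
             lassoc mul ld (x i1) (x i2) (x i3);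
             lsq mul (x i1); lsq mul (x i2); lsq mul (x i3)],
      (* (2) *)
      #|M| = (2 ^ 10)%N
    & (* (3): M_3 is the free E-loop on x_1, x_2, x_3 *)
      [/\ E_identities mul ld 1 (fun m => m \in M),
          loop_generated M mul [set x i1; x i2; x i3]
        & forall (T : Type) (mulL ldL rdL : T -> T -> T) (eL : T),
            E_loop mulL ldL rdL eL ->
            forall l : 'I_3 -> T,
            exists f : gT -> T,
              (forall m n, m \in M -> n \in M -> f (mul m n) = mulL (f m) (f n))
              /\ (forall i, f (x i) = l i)]].
Proof.
move=> _ _ gen rel card sigmaM rhoM sigma_gens rho_gens M mul ld x.
pose ph := phi gT a b.
have ph_inj : injective ph := phi_inj _ _ _ gen rel card.
have ph_mul p q : mul (ph p) (ph q) = ph (clmul p q).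
  exact: (phi_mul _ _ _ _ _ rel sigmaM rhoM sigma_gens rho_gens).
have phP m : reflect (exists q, m = ph q) (m \in M).
  exact: (phiP _ _ _ _ _ gen rel sigmaM rhoM sigma_gens rho_gens).
have ph1 : ph code_loop1 = 1 := phi1_loop _ _ _.
have ph_gen k : ph (code_gen k) = (ia gT a k)^-1 * sigma (ia gT a k).
  exact: (phi_gen _ _ _ _ rel sigmaM sigma_gens).
have genX (X : {set gT}) : x i1 \in X -> x i2 \in X -> x i3 \in X -> loop_generated M mul X.
  move=> X1 X2 X3; apply: (transfer_generated _ _ _ _ _ _ cl_E_loop _ _ _ phP ph_mul).
  move=> P PX PM Pld; apply: cl_generated => // k.
  by apply: PX; rewrite ph_gen; case: k.
split.
- exact: (transfer_moufang _ _ _ _ _ _ cl_E_loop _ _ _ ph_inj phP ph_mul ph1).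
- by apply: genX; rewrite !inE eqxx ?orbT.
- have -> : M = ph @: [set: code_loop].
    apply/setP=> m; apply/phP/imsetP => [[q ->]|[q _ ->]]; exists q => //.
  by rewrite card_imset // cardsT !card_prod !card_bool.
split.
- exact: (transfer_identities _ _ _ _ _ _ cl_E_loop _ _ _ ph_inj phP ph_mul ph1).
- by apply: genX; rewrite !inE eqxx ?orbT.
move=> T mulL ldL rdL eL EL l.
pose F := cl_eval T mulL ldL eL (l i1) (l i2) (l i3).
(* [f] is [F] after the inverse of [ph], found by search; outside M it takes the default value
   [eL]. *)
pose f g := odflt eL (omap F [pick q | ph q == g]).
have fE q : f (ph q) = F q.
  rewrite /f; case: pickP => [r /eqP/ph_inj -> //|/(_ q)]; by rewrite eqxx.
exists f; split=> [_ _ /phP[p ->] /phP[q ->]|i].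
  by rewrite ph_mul !fE; apply: cl_evalM EL _ _ _ _ _.
have el1 := el1x _ _ _ _ _ EL; have e1l := elx1 _ _ _ _ _ EL.
have [k -> ->] : exists2 k, i = match k with I1 => i1 | I2 => i2 | I3 => i3 end &
    x i = ph (code_gen k).
  by case: (ord3P i) => ->; [exists I1|exists I2|exists I3] => //; rewrite ph_gen.
by rewrite fE; case: k; rewrite /F /cl_eval /= /loop_rep /= ?el1 ?e1l.
Qed.
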